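(* The number of sum-free sets $A\subseteq[n]$ satisfying $2n+1\notin\sum A$ is $\Theta(2^{n/3})$ (as $n\to\infty$).
   Context: $[n]=\{1,\ldots,n\}$. A set $A$ of integers is sum-free if there are no (not necessarily distinct) $x,y,z\in A$ with $x+y=z$. For $k \ge 0$, $kA=\{a_1+\cdots+a_k \mid a_1,\ldots,a_k\in A\}$ (repetitions allowed, $0A=\{0\}$), and $\sum A=\bigcup_{k\ge 0} kA$. *)

(* Defs.v *)
From mathcomp Require Import all_boot all_order all_algebra finmap.
From mathcomp Require Import all_classical all_reals all_analysis.

Set Implicit Arguments.
Unset Strict Implicit.
Unset Printing Implicit Defensive.

Local Open Scope nat_scope.
Local Open Scope classical_set_scope.

Definition interval1 (n : nat) : {fset nat} := [fset x in iota 1 n]%fset.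

Definition sum_free (A : set nat) : Prop :=
  ~ exists x y z : nat, [/\ A x, A y, A z & x + y = z].

Definition kfold (k : nat) (A : set nat) : set nat :=
  [set s | exists a : 'I_k -> nat, (forall i, A (a i)) /\ s = \sum_(i < k) a i].

Definition all_sums (A : set nat) : set nat := \bigcup_k kfold k A.

Definition sum_free_avoiding (n m : nat) : {fset {fset nat}} :=
  [fset A in fpowerset (interval1 n) |
    `[< sum_free [set` A] /\ ~ all_sums [set` A] m >]]%fset.

(* Main.v *)
Require Import Defs.
From mathcomp Require Import all_boot all_order all_algebra finmap.
From mathcomp Require Import all_classical all_reals all_analysis.
From mathcomp Require Import zify ring lra.
Import Order.TTheory GRing.Theory Num.Theory.
Import numFieldNormedType.Exports.
From mathcomp Require Import fintype finset bigop.

Set Implicit Arguments.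
Unset Strict Implicit.
Unset Printing Implicit Defensive.

(** Let [f = 2n + 1] and let [S] be the additive semigroup generated by [A], so
    that [f] is not in [S].  Every set of integers [x <= n] with [3x > f] is
    admissible, which gives the lower bound.  For the upper bound, sort the
    admissible sets by their minimum [a]; when [3a < f], put [s = f - 3a].  We
    show that at most [C 2^(f/6 - c s)] admissible sets have minimum [a], and
    these bounds form a geometric series.

    Every [t] in [A] forbids pairs [y, z] in [A]: those with [t | f - (y + z)]
    and those with [|y - z| = t].  A set of integers in [(t, n]] without such
    pairs has at most about [max(t/2, 0.325 n)] elements, visibly fewer than [n/3]
    when [t] is well below [2n/3].  If [A] has many elements [t] well below
    [f/3] (the gap being a fixed fraction of [s]), fix boundedly many of them:
    [A] is independent in the union of their graphs, and a Kleitman--Winston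
    count of independent sets loses only a factor [2^(small * s)] over 2 to the
    maximal size of a set spanning few edges.  (A pair may be forbidden by many
    [t] at once if these are tiny; below [n/40] only differences are used, within
    the at most [a/2] residue classes modulo [a] that [A] can occupy.)  If instead
    [A] has boundedly many such elements, the pairs forbidden by [a] alone contain
    a matching with a constant times [s] edges above about [f/3], and every edge
    of the matching gains a factor [3/4]. *)

(** * Counting independent sets *)

Section IndependentSets.
Variables (T : finType) (e : rel T).
Implicit Types (A B U V : {set T}) (v w : T).

Definition indep A := [forall x in A, forall y in A, (x != y) ==> ~~ e x y].

Definition ind U := #|[set A : {set T} | (A \subset U) && indep A]|.

Definition nbrs U v := [set w in U | (w != v) && e v w].

Lemma indepP A :
  reflect (forall x y, x \in A -> y \in A -> x != y -> ~~ e x y) (indep A).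
Proof.
apply: (iffP forall_inP) => [H x y xA yA|H x xA].
  by move/forall_inP: (H x xA) => /(_ y yA)/implyP.
by apply/forall_inP => y yA; apply/implyP; apply: H.
Qed.

Lemma indep_sub A B : A \subset B -> indep B -> indep A.
Proof.
move=> /subsetP AB /indepP iB; apply/indepP => x y xA yA.
by apply: iB; apply: AB.
Qed.

Lemma ind_mono U V : U \subset V -> ind U <= ind V.
Proof.
move=> UV; apply/subset_leq_card/subsetP => A; rewrite !inE => /andP[AU ->].
by rewrite (subset_trans AU UV).
Qed.

Lemma ind_le_pow U : ind U <= 2 ^ #|U|.
Proof.
rewrite -card_powerset; apply/subset_leq_card/subsetP => A.
by rewrite !inE => /andP[].
Qed.

(** The sets avoiding [v] give the first term. A set containing [v] is recovered from its other
    elements, none of which is a neighbour of [v]. *)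
Lemma ind_split U v :
  ind U <= ind (U :\ v) + ind ((U :\ v) :\: nbrs U v).
Proof.
rewrite /ind.
set F := [set A : {set T} | (A \subset U) && indep A].
rewrite -(cardsID [set A : {set T} | v \in A] F) addnC leq_add//.
  apply/subset_leq_card/subsetP => A; rewrite !inE => /andP[vA /andP[AU ->]].
  by rewrite andbT subsetD1 AU.
rewrite -(card_in_imset (f := fun A => A :\ v)); last first.
  move=> A B; rewrite !inE => /andP[_ vA] /andP[_ vB] AB.
  by rewrite -(setD1K vA) AB setD1K.
apply/subset_leq_card/subsetP => _ /imsetP[A + ->].
rewrite !inE => /andP[/andP[AU iA] vA].
rewrite (indep_sub (subsetDl _ _) iA) andbT.
apply/subsetP => w; rewrite !inE => /andP[wv wA].
rewrite wv (subsetP AU w wA) /= andbT.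
by move/indepP: iA => -> //; rewrite eq_sym.
Qed.

Lemma ind_del U v : ind U <= 2 * ind (U :\ v).
Proof.
apply: (leq_trans (ind_split U v)); rewrite mul2n -addnn leq_add2l.
by apply/ind_mono/subsetDl.
Qed.

Lemma ind_free U V : ind (U :|: V) <= 2 ^ #|U| * ind V.
Proof.
have [m] := ubnP #|U|; elim: m U => // m IH U Um.
have [->|[v vU]] := set_0Vmem U.
  by rewrite cards0 mul1n set0U.
have sub : (U :|: V) :\ v \subset (U :\ v) :|: V.
  by apply/subsetP => w; rewrite !inE; case: (w == v).
have cU := cardsD1 v U; rewrite vU in cU.
apply: leq_trans (ind_del _ v) _.
apply: leq_trans (leq_mul (leqnn 2) (ind_mono sub)) _.
rewrite cU expnS -mulnA leq_mul2l /=; apply: IH; lia.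
Qed.

(** Without [v], dropping [w] costs a factor 2; with [v], the edge excludes [w]. So 3 of the 4
    traces on the pair survive. *)
Lemma ind_pair U v w : v \in U -> w \in U -> v != w -> e v w ->
  ind U <= 3 * ind (U :\ v :\ w).
Proof.
move=> vU wU vw evw.
apply: leq_trans (ind_split U v) _.
have -> : 3 = 2 + 1 by []; rewrite mulnDl mul1n.
apply: leq_add; first exact: ind_del.
apply/ind_mono/subsetP => x; rewrite !inE => /and3P[+ -> ->].
by rewrite !andbT; apply: contra => /eqP ->; rewrite wU eq_sym vw evw.
Qed.

Lemma ind_matching (s : seq (T * T)) U :
  uniq (flatten [seq [:: p.1; p.2] | p <- s]) ->
  (forall p, p \in s -> [/\ p.1 \in U, p.2 \in U & e p.1 p.2]) ->
  ind U * 4 ^ size s <= 3 ^ size s * 2 ^ #|U|.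
Proof.
elim: s U => [|[v w] s IH] U /=.
  by move=> _ _; rewrite muln1 mul1n ind_le_pow.
rewrite inE negb_or => /andP[/andP[vw vs] /andP[ws us]] H.
have [vU wU evw] := H _ (mem_head _ _).
have cv := cardsD1 v U; have cw := cardsD1 w (U :\ v).
rewrite !inE eq_sym vw wU vU /= in cv cw.
have mem p : p \in s -> (p.1 \in flatten [seq [:: p.1; p.2] | p <- s]) /\
    (p.2 \in flatten [seq [:: p.1; p.2] | p <- s]).
  move=> ps; split; apply/flattenP; exists [:: p.1; p.2].
  - exact: (map_f (fun p => [:: p.1; p.2])).
  - by rewrite mem_head.
  - exact: (map_f (fun p => [:: p.1; p.2])).
  - by rewrite !inE eqxx orbT.
have -> : #|U| = (#|U :\ v :\ w|).+2 by lia.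
have IHs : ind (U :\ v :\ w) * 4 ^ size s <= 3 ^ size s * 2 ^ #|U :\ v :\ w|.
  apply: IH => // p ps.
  have [|p1 p2 ep] := H p; first by rewrite inE ps orbT.
  have [m1 m2] := mem p ps.
  rewrite !inE p1 p2 ep !andbT; split => //; apply/andP; split.
  - by apply: contraNneq ws => <-.
  - by apply: contraNneq vs => <-.
  - by apply: contraNneq ws => <-.
  - by apply: contraNneq vs => <-.
apply: leq_trans (leq_mul (ind_pair vU wU vw evw) (leqnn _)) _.
rewrite !expnS /=; move: (4 ^ _) (3 ^ _) (2 ^ _) (ind _) IHs => a b c i IHs.
nia.
Qed.

End IndependentSets.

Lemma card_fibers (T S : finType) (F : {set T}) (h : T -> S) (Y : {set S}) (m : nat) :
  (forall x, x \in F -> h x \in Y) ->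
  (forall y, y \in Y -> #|[set x in F | h x == y]| <= m) ->
  #|F| <= #|Y| * m.
Proof.
move=> hY hm; rewrite -sum1_card.
rewrite (partition_big h (fun y => y \in Y)) //= -sum_nat_const.
apply: leq_sum => y yY; rewrite sum1_card.
apply: leq_trans (hm y yY); apply: subset_leq_card; apply/subsetP => x.
by rewrite !inE /=.
Qed.

Lemma card_small_subsets (T : finType) (Q : {set T}) (k : nat) :
  #|[set E : {set T} | (E \subset Q) && (#|E| <= k)]| <= (#|Q|).+1 ^ k.
Proof.
elim: k => [|k IH].
  rewrite expn0 -(cards1 (@set0 T)); apply/subset_leq_card/subsetP => E.
  by rewrite !inE leqn0 cards_eq0 => /andP[].
set F := [set E : {set T} | _] in IH *.
(* [None] adjoins nothing, which is how the empty set is reached. *)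
pose g (p : option T * {set T}) := if p.1 is Some x then x |: p.2 else p.2.
pose D := [set p : option T * {set T} |
  (if p.1 is Some x then x \in Q else true) && (p.2 \in F)].
have cD : #|D| <= (#|Q|).+1 * (#|Q|).+1 ^ k.
  have -> : D = setX [set o : option T | if o is Some x then x \in Q else true] F.
    by apply/setP => [[z E]]; rewrite !inE.
  rewrite cardsX leq_mul // (cardsD1 None) !inE add1n ltnS.
  have -> : [set o : option T | if o is Some x then x \in Q else true] :\ None
      = [set Some x | x in Q].
    apply/setP => [[x|]]; rewrite !inE /=; last by apply/esym/negbTE/imsetP => [[]].
    by rewrite mem_imset // => ? ? [].
  by rewrite card_imset // => ? ? [].
rewrite expnS; apply: leq_trans cD; apply: leq_trans (leq_imset_card g _).
apply/subset_leq_card/subsetP => E; rewrite !inE => /andP[EQ Ek].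
have [E0|[x xE]] := set_0Vmem E.
  by apply/imsetP; exists (None, E) => //; rewrite !inE EQ E0 cards0.
apply/imsetP; exists (Some x, E :\ x); last by rewrite /g /= setD1K.
rewrite !inE /= (subsetP EQ x xE) (subset_trans (subsetDl _ _) EQ) /=.
by have := cardsD1 x E; rewrite xE; lia.
Qed.

Local Open Scope ring_scope.

(** * Powers of two and the container bound *)

Section RealEstimates.
Variable R : realType.
Implicit Types (x y d : R).

Lemma pow2D x y : 2 `^ (x + y) = 2 `^ x * 2 `^ y :> R.
Proof. by rewrite powRD // pnatr_eq0 implybT. Qed.

Lemma pow2_gt0 x : 0 < 2 `^ x :> R.
Proof. exact: powR_gt0. Qed.

Lemma pow2_le x y : x <= y -> 2 `^ x <= 2 `^ y :> R.
Proof. by apply: ler_powR; rewrite ler1n. Qed.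

Lemma pow2_nat (k : nat) : (2 ^ k)%:R = 2 `^ k%:R :> R.
Proof. by rewrite powR_mulrn // natrX. Qed.

Lemma pow2_gt1 d : 0 < d -> 1 < 2 `^ d :> R.
Proof.
move=> d0; rewrite -[ltLHS](powRr0 (2 : R)) lt_neqAle pow2_le ?(ltW d0) // andbT.
rewrite eq_sym; apply/eqP => /(congr1 (@ln R)).
rewrite !ln_powR mul0r => /eqP; rewrite mulf_eq0 gt_eqF //= gt_eqF // ln_gt0 //.
by rewrite ltr1n.
Qed.

Lemma bernoulli_ge (h : R) (k : nat) : 0 <= h -> 1 + k%:R * h <= (1 + h) ^+ k.
Proof.
move=> h0; elim: k => [|k IH]; first by rewrite mul0r addr0 expr0.
rewrite exprS; apply: (@le_trans _ _ ((1 + h) * (1 + k%:R * h))).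
  rewrite -natr1; have : 0 <= k%:R * h * h by rewrite !mulr_ge0.
  by nra.
by rewrite ler_wpM2l // addr_ge0.
Qed.

(** This chooses the degree threshold for [ind_le_of_low_degree]. The two powers of [b] differ by
    [(b - 1) * b ^ D], which by Bernoulli is at least [D * (b - 1) ^ 2]. *)
Lemma base_exists d : 0 < d ->
  exists D : nat, (2 `^ d) ^+ D + 1 <= (2 `^ d) ^+ D.+1 :> R.
Proof.
move=> d0; set b := 2 `^ d : R.
have h0 : 0 < b - 1 by rewrite subr_gt0 pow2_gt1.
have [D HD] : exists D : nat, (b - 1)^-1 ^+ 2 < D%:R.
  exists (Num.bound ((b - 1)^-1 ^+ 2)).
  by apply: archi_boundP; rewrite exprn_ge0 // invr_ge0 ltW.
exists D.
have := bernoulli_ge D (ltW h0); rewrite [1 + (b - 1)]addrC subrK => HB.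
have : 1 <= (b - 1) * b ^+ D.
  apply: le_trans (ler_wpM2l (ltW h0) HB).
  have H1 : 1 <= (b - 1) * (D%:R * (b - 1)).
    rewrite mulrCA -expr2 -ler_pdivrMr ?exprn_gt0 // div1r -exprVn; exact: ltW.
  by rewrite [leRHS]mulrDr mulr1; move: (ltW h0); lra.
by rewrite exprS mulrBl mul1r; lra.
Qed.

Lemma poly_le_pow2 (k : nat) d : 0 < d ->
  exists2 C : R, 0 < C & forall m : nat, (m.+2)%:R ^+ k <= C * 2 `^ (d * m%:R).
Proof.
(* Each of the [k] factors gets a share of the rate [d]; dividing by [k + 1] also covers [k = 0]. *)
move=> d0; set d' := d / k.+1%:R.
have d'0 : 0 < d' by rewrite divr_gt0.
have [h h0 hE] : exists2 h : R, 0 < h & 2 `^ d' = 1 + h.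
  by exists (2 `^ d' - 1); rewrite ?subr_gt0 ?pow2_gt1 // addrC subrK.
have C0 : 0 < 2 + h^-1 by rewrite addr_gt0 // invr_gt0.
exists ((2 + h^-1) ^+ k); first exact: exprn_gt0.
move=> m.
have H : m.+2%:R <= (2 + h^-1) * (2 `^ d') ^+ m.
  rewrite hE; apply: le_trans (ler_wpM2l (ltW C0) (bernoulli_ge m (ltW h0))).
  have -> : (2 + h^-1) * (1 + m%:R * h) = m.+2%:R + (2 * (m%:R * h) + h^-1).
    by rewrite -addn2 natrD; field; rewrite gt_eqF.
  by rewrite lerDl addr_ge0 ?mulr_ge0 ?invr_ge0 // ltW.
apply: le_trans (lerXn2r k _ _ H) _; rewrite ?nnegrE ?ler0n //.
  by rewrite mulr_ge0 ?exprn_ge0 ?powR_ge0 // ltW.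
rewrite exprMn ler_wpM2l ?exprn_ge0 ?(ltW C0) //.
rewrite -exprM -powR_mulrn ?powR_ge0 // -powRrM.
apply: pow2_le; rewrite natrM mulrCA [d * _]mulrC ler_wpM2l ?ler0n // /d'.
by rewrite mulrAC ler_pdivrMr ?ltr0n // ler_wpM2l ?(ltW d0) // ler_nat.
Qed.

Lemma ind_matching_pow2 (T : finType) (e : rel T) (s : seq (T * T)) (U : {set T}) :
  uniq (flatten [seq [:: p.1; p.2] | p <- s]) ->
  (forall p, p \in s -> [/\ p.1 \in U, p.2 \in U & e p.1 p.2]) ->
  (ind e U)%:R <= 2 `^ (#|U|%:R - 2 / 5 * (size s)%:R) :> R.
Proof.
move=> us H; have := ind_matching us H; rewrite -(ler_nat R) !natrM => M.
(* Compare fifth powers: [(3/4)^5 = 243/1024 < 1/4]. *)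
have q : 3 / 4 <= 2 `^ (- (2 / 5)) :> R.
  rewrite -(@ler_pXn2r _ 5) ?nnegrE ?powR_ge0 //.
  rewrite -[leRHS]powR_mulrn ?powR_ge0 // -powRrM.
  have -> : - (2 / 5) * 5%:R = - 2%:R :> R by field.
  by rewrite powRN powR_mulrn //; lra.
have P : (3 / 4) ^+ size s <= 2 `^ (- (2 / 5 * (size s)%:R)) :> R.
  rewrite -mulNr powRrM powR_mulrn ?powR_ge0 //.
  by apply: lerXn2r; rewrite ?nnegrE ?powR_ge0 //; lra.
rewrite pow2D -pow2_nat.
apply: le_trans (ler_wpM2l (ler0n _ _) P).
rewrite expr_div_n mulrA ler_pdivlMr ?exprn_gt0 //.
by move: M; rewrite !natrX [3 ^+ _ * _]mulrC.
Qed.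

(* Kleitman--Winston: choosing a vertex of degree at least [D] deletes its
   neighbourhood, so such vertices only cost a factor [b] close to 1 each. *)
Lemma ind_le_of_low_degree (T : finType) (e : rel T) (V : {set T}) (B b : R)
    (D : nat) :
  1 <= b -> b ^+ D + 1 <= b ^+ D.+1 ->
  (forall U : {set T}, U \subset V ->
    (forall v, v \in U -> (#|nbrs e U v| < D)%N) -> #|U|%:R <= B) ->
  (ind e V)%:R <= 2 `^ B * b ^+ #|V|.
Proof.
move=> b1 bD HB.
suff H m (U : {set T}) : (#|U| < m)%N -> U \subset V ->
    (ind e U)%:R <= 2 `^ B * b ^+ #|U| by exact: H (ltnSn _) _.
have b0 : 0 < b by exact: lt_le_trans b1.
elim: m U => // m IH U Um UV.
have [/forall_inP low|] := boolP [forall v in U, #|nbrs e U v| < D]%N.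
  apply: (@le_trans _ _ (2 `^ #|U|%:R)).
    by rewrite -pow2_nat ler_nat ind_le_pow.
  rewrite -[leLHS]mulr1 ler_pM ?powR_ge0 ?pow2_le ?HB //.
  exact: exprn_ege1.
rewrite negb_forall_in => /exists_inP[v vU]; rewrite -leqNgt => dv.
have c1 := cardsD1 v U; rewrite vU in c1.
have sub : nbrs e U v \subset U :\ v.
  by apply/fintype.subsetP => w; rewrite !inE => /and3P[-> ->].
have c2 : #|(U :\ v) :\: nbrs e U v| = (#|U :\ v| - #|nbrs e U v|)%N.
  by rewrite cardsD (setIidPr sub).
have lt1 : (#|U :\ v| < m)%N by move: Um; lia.
have S1 : U :\ v \subset V by exact: fintype.subset_trans (subD1set _ _) UV.
have I1 := IH _ lt1 S1.
have I2 : (ind e ((U :\ v) :\: nbrs e U v))%:R <=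
   2 `^ B * b ^+ #|(U :\ v) :\: nbrs e U v|.
  apply: IH; first by move: Um; lia.
  exact: fintype.subset_trans (subsetDl _ _) S1.
apply: (@le_trans _ _ ((ind e (U :\ v))%:R +
    (ind e ((U :\ v) :\: nbrs e U v))%:R)).
  by rewrite -natrD ler_nat ind_split.
apply: le_trans (lerD I1 I2) _.
rewrite -mulrDr ler_wpM2l ?powR_ge0 //.
have le2 := subset_leq_card sub.
set k := (#|U :\ v| - D)%N.
have -> : #|U :\ v| = (k + D)%N by move: dv le2; rewrite /k; lia.
have -> : #|U| = (k + D.+1)%N by move: dv le2; rewrite /k; lia.
apply: (@le_trans _ _ (b ^+ (k + D) + b ^+ k)).
  by rewrite lerD2l ler_weXn2l // c2 /k; move: dv le2; lia.
by rewrite !exprD -[X in _ + X]mulr1 -mulrDr ler_wpM2l // exprn_ge0 // ltW.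
Qed.

End RealEstimates.

Local Close Scope ring_scope.

(** * Sum-avoiding residues, covers and reflections *)

(** The injection [i -> f - i] modulo [t] sends [X] into its complement. *)
Lemma card_sum_avoiding (t f : nat) (X : {set 'I_t}) :
  (forall i j, i \in X -> j \in X -> i + j != f %[mod t]) -> 2 * #|X| <= t.
Proof.
case: t X => [|t] X H; first by rewrite (_ : X = set0) ?cards0 //; apply/setP => [[]].
pose g (i : 'I_t.+1) : 'I_t.+1 := inord ((f + (t.+1 - i)) %% t.+1).
have gE i : g i + i = f %[mod t.+1].
  rewrite inordK ?ltn_pmod // modnDml -addnA subnK ?(ltnW (ltn_ord i)) //.
  by rewrite modnDr.
have gI : injective g.
  move=> i j gij; apply/val_inj => /=.
  have /eqP := etrans (gE i) (esym (gE j)).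
  by rewrite gij eqn_modDl !modn_small ?ltn_ord // => /eqP.
have D : [disjoint X & [set g i | i in X]].
  rewrite disjoint_subset; apply/fintype.subsetP => x xX; rewrite !inE.
  apply/imsetP => [[i iX xE]]; have := H _ _ xX iX.
  by rewrite xE gE eqxx.
have := max_card (X :|: [set g i | i in X]); rewrite card_ord cardsU.
rewrite (disjoint_setI0 D) cards0 subn0 card_imset // mul2n -addnn; exact.
Qed.

Lemma card_cover (T S : finType) (F : {set T}) (Y : {set S}) (G : S -> {set T})
    (m : nat) :
  (forall x, x \in F -> exists2 y, y \in Y & x \in G y) ->
  (forall y, y \in Y -> #|G y| <= m) -> #|F| <= #|Y| * m.
Proof.
move=> FG Gm; pose h x := [pick y in Y | x \in G y].
have hE x : x \in F -> exists y, [/\ h x = Some y, y \in Y & x \in G y].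
  move=> xF; rewrite /h; case: pickP => [y /andP[yY xy]|none]; first by exists y.
  by have [y yY xy] := FG x xF; have := none y; rewrite /= yY xy.
rewrite -(card_imset (mem Y) (f := Some)); last by move=> ? ? [].
apply: (@card_fibers _ _ _ h).
  by move=> x /hE[y [-> yY _]]; apply/imsetP; exists y.
move=> _ /imsetP[y yY ->]; apply: leq_trans (Gm y yY).
apply/subset_leq_card/fintype.subsetP => x; rewrite !inE => /andP[/hE[z [-> _ xz]]].
by move=> /eqP[<-].
Qed.

(** A member is determined by its small trace on [Q], which has polynomially many values, and by an
    independent set outside [Q]. The graph may depend on the trace. *)
Lemma card_low_high (T : finType) (F : {set {set T}}) (Q : {set T}) (k M : nat)
    (e : {set T} -> rel T) (H : {set T} -> {set T}) :
  (forall A, A \in F ->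
    [/\ #|A :&: Q| <= k, A :\: Q \subset H (A :&: Q),
        indep (e (A :&: Q)) (A :\: Q) & ind (e (A :&: Q)) (H (A :&: Q)) <= M]) ->
  #|F| <= (#|Q|).+1 ^ k * M.
Proof.
move=> HF.
apply: leq_trans (leq_mul (card_small_subsets Q k) (leqnn M)).
set Y := [set E : {set T} | _].
(* The bound [M] is known only for traces of members of [F], so the other small sets are
   discarded. *)
set Y' := [set E in Y | ind (e E) (H E) <= M].
apply: (@leq_trans (#|Y'| * M)); last first.
  rewrite leq_mul // subset_leq_card //; apply/fintype.subsetP => E.
  by rewrite inE => /andP[].
apply: (@card_fibers _ _ _ (fun A => A :&: Q)) => [A /HF[Ak AH iA iM]|E].
  by rewrite !inE subsetIr Ak iM.
rewrite !inE => /andP[_ EM]; apply: leq_trans EM.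
rewrite -(card_in_imset (f := fun A => A :\: Q)); last first.
  move=> A B; rewrite !inE => /andP[_ /eqP AQ] /andP[_ /eqP BQ] AB.
  by rewrite -(setID A Q) -(setID B Q) AB AQ BQ.
apply/subset_leq_card/fintype.subsetP => _ /imsetP[A + ->].
by rewrite !inE => /andP[/HF[Ak AH iA iM] /eqP <-]; rewrite AH iA.
Qed.

Lemma card_le_range N (A : {set 'I_N}) (l k : nat) :
  (forall x, x \in A -> l <= x < l + k) -> #|A| <= k.
Proof.
move=> H; rewrite -(size_iota l k) cardE -(size_map val).
apply: uniq_leq_size; first by rewrite map_inj_uniq ?enum_uniq //; exact: val_inj.
by move=> _ /mapP[x + ->]; rewrite mem_enum mem_iota => /H.
Qed.

(** The points of [U] whose image leaves [U] have images disjoint from [U]; these images and [U]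
    itself fit together in [r]. *)
Lemma card_reflection N (U : {set 'I_N}) (g : nat -> nat) (r : seq nat) :
  {in U &, forall x y : 'I_N, g x = g y -> x = y} ->
  (forall y, y \in U -> (val y \in r) && (g y \in r)) ->
  2 * #|U| <= size r + #|[set y in U | [exists z in U, val z == g y]]|.
Proof.
move=> gI Ur; set W := [set y in U | _].
have WU : W \subset U by apply/fintype.subsetP => y; rewrite inE => /andP[].
have cD : #|U :\: W| = #|U| - #|W| by rewrite cardsD (setIidPr WU).
have := subset_leq_card WU.
suff : #|U| + #|U :\: W| <= size r by lia.
rewrite !cardE -(size_map val) -[X in _ + X](size_map (fun y : 'I_N => g y)) -size_cat.
apply: uniq_leq_size.
  rewrite cat_uniq map_inj_uniq ?enum_uniq //=; last exact: val_inj.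
  apply/andP; split.
    apply/hasPn => _ /mapP[y + ->]; rewrite mem_enum !inE => /andP[+ yU].
    rewrite yU /=; apply: contra => /mapP[z]; rewrite mem_enum => zU gz.
    by apply/exists_inP; exists z => //; apply/eqP.
  rewrite map_inj_in_uniq ?enum_uniq // => x y; rewrite !mem_enum !inE.
  by move=> /andP[_ xU] /andP[_ yU]; exact: gI.
move=> z; rewrite mem_cat => /orP[] /mapP[y]; rewrite mem_enum ?inE.
  by move=> yU ->; have /andP[] := Ur y yU.
by move=> /andP[_ yU] ->; have /andP[] := Ur y yU.
Qed.

Lemma size_filter_residues (a m : nat) (X : {set 'I_a}) : 0 < a ->
  size [seq y <- iota 0 m | y %% a \in [seq val i | i in X]] <= #|X| * (m %/ a).+1.
Proof.
move=> a0; rewrite mulnC cardE -(size_map val) -(size_iota 0 (m %/ a).+1).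
rewrite -(size_allpairs (fun q i => q * a + i)); apply: uniq_leq_size.
  by rewrite filter_uniq ?iota_uniq.
move=> y; rewrite mem_filter mem_iota add0n => /andP[yX] /andP[_ ym].
apply/allpairsP; exists (y %/ a, y %% a); rewrite -divn_eq mem_iota /=; split => //.
by rewrite ltnS leq_div2r // ltnW.
Qed.

(** * Admissible sets and their minimum *)

(* [S] stands for the semigroup generated by [A]; only its closure properties
   are used. *)
Definition valid n (A : {set 'I_n.+1}) : Prop :=
  (forall x y z : 'I_n.+1, x \in A -> y \in A -> z \in A -> x + y <> z) /\
  exists S : nat -> Prop, [/\ S 0, (forall x y, S x -> S y -> S (x + y)),
    (forall x : 'I_n.+1, x \in A -> S x) & ~ S (2 * n + 1)].

Section Valid.
Variables (n : nat) (A : {set 'I_n.+1}).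
Hypothesis vA : valid A.
Implicit Types (x y z t a : 'I_n.+1) (j : nat).

Lemma valid_gt0 x : x \in A -> 0 < x.
Proof.
move=> xA; case: vA => sf _; case: (posnP x) => // x0.
by case: (sf x x x xA xA xA); rewrite x0.
Qed.

(** Allowing [z] and [t] to be 0 makes one statement serve for two, three or four summands plus a
    multiple of [a]. *)
Lemma valid_sum_neq x y z t a j :
  x \in A -> y \in A -> z \in A \/ z = 0 :> nat -> t \in A \/ t = 0 :> nat ->
  a \in A -> x + y + z + t + j * a <> 2 * n + 1.
Proof.
case: vA => _ [S [S0 SD SA Sf]] xA yA zA tA aA E; apply: Sf; rewrite -E.
have S' u : u \in A \/ u = 0 :> nat -> S u by case=> [/SA//|->].
have Sj : S (j * a) by elim: j {E} => // j IH; rewrite mulSn; apply: SD; auto.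
by apply: (SD) => //; apply: (SD); auto; apply: (SD); auto; apply: SD; auto.
Qed.

Lemma valid_dvd_neq y z t : y \in A -> z \in A -> t \in A ->
  ~~ (t %| 2 * n + 1 - (y + z)).
Proof.
move=> yA zA tA; apply/negP => /dvdnP[j E].
have := @valid_sum_neq y z ord0 ord0 t j yA zA (or_intror erefl) (or_intror erefl) tA.
by have := ltn_ord y; have := ltn_ord z; move: E => /=; lia.
Qed.

Lemma valid_diff_neq y z t : y \in A -> z \in A -> t \in A -> y + t <> z.
Proof. by move=> yA zA tA; case: vA => sf _; exact: sf. Qed.

End Valid.

Definition min_family n (a : 'I_n.+1) : {set {set 'I_n.+1}} :=
  [set A : {set 'I_n.+1} | [&& `[< valid A >], a \in A & [forall x in A, a <= x]]].

Lemma min_familyP n (a : 'I_n.+1) A : A \in min_family a ->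
  [/\ valid A, a \in A & forall x, x \in A -> a <= x].
Proof.
by rewrite inE => /and3P[/asboolP vA aA /forall_inP mA].
Qed.

Lemma uniq_flatten_pairs (I T : eqType) (J : seq I) (p q : I -> T) :
  uniq J -> {in J &, injective p} -> {in J &, injective q} ->
  {in J &, forall i j, p i != q j} ->
  uniq (flatten [seq [:: x.1; x.2] | x <- [seq (p i, q i) | i <- J]]).
Proof.
move=> uJ pI qI pq.
have perm : perm_eq (flatten [seq [:: x.1; x.2] | x <- [seq (p i, q i) | i <- J]])
    (map p J ++ map q J).
  elim: J {uJ pI qI pq} => //= i J IH.
  by rewrite perm_cons perm_sym perm_catC /= perm_cons perm_catC perm_sym.
rewrite (perm_uniq perm) cat_uniq !map_inj_in_uniq // uJ /= andbT.
apply/hasPn => _ /mapP[j jJ ->]; apply/mapP => -[i iJ /eqP].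
by rewrite eq_sym; apply/negP/pq.
Qed.

(** * Sets with few low elements *)

Definition excess n (a : 'I_n.+1) : nat := 2 * n + 1 - 3 * a.

(** The factor 64 fixes how far below [f/3] a low element lies: by at least [s/192]. *)
Definition low n (a : 'I_n.+1) : {set 'I_n.+1} :=
  [set t : 'I_n.+1 | excess a <= 64 * (2 * n + 1 - 3 * t)].

(** About [f/6] integers lie between [f/3] and [n], so [2^(f/6)] is the size of the extremal family;
    [1/1000] is the constant [c] of the geometric series. *)
Definition target (R : realType) n (a : 'I_n.+1) : R :=
  (2 `^ ((2 * n + 1)%:R / 6 - (excess a)%:R / 1000))%R.

Lemma card_high n (a : 'I_n.+1) : 3 * a < 2 * n + 1 ->
  192 * #|~: low a| <= 32 * (2 * n + 1) + 96 + excess a.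
Proof.
move=> a3; rewrite /excess.
set l := ((64 * (2 * n + 1) - excess a) %/ 192).+1.
have : #|~: low a| <= n.+1 - l.
  apply: (@card_le_range _ _ l) => x; rewrite !inE /l /excess.
  by have := ltn_ord x; lia.
by rewrite /l /excess; lia.
Qed.

Lemma card_low_from n (a : 'I_n.+1) : 3 * a < 2 * n + 1 ->
  #|[set t in low a | a <= t]| <= excess a.
Proof.
move=> a3; apply: (@card_le_range _ _ a) => x; rewrite !inE /excess => /andP[].
by move: a3; lia.
Qed.

Definition top_edge n (a : 'I_n.+1) : rel 'I_n.+1 :=
  fun y z => (y + z <= 2 * n + 1) && (a %| 2 * n + 1 - (y + z)).

(* The involution [y -> f - a - y] of the elements above [f/3]. *)
Lemma middle_matching n (a : 'I_n.+1) : 3 * a < 2 * n + 1 -> n.+2 <= 3 * a ->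
  exists s : seq ('I_n.+1 * 'I_n.+1),
  [/\ uniq (flatten [seq [:: p.1; p.2] | p <- s]),
      forall p, p \in s -> [/\ p.1 \in ~: low a, p.2 \in ~: low a & top_edge a p.1 p.2]
    & excess a <= 50 * size s + 50].
Proof.
move=> a3 na.
(* [6 * m < excess a] is what makes [u i < v i] for all [i < m]; the lower bound on [a] keeps [v i]
   at most [n]. *)
have [m mE mS] : exists2 m, 6 * m < excess a & excess a <= 50 * m + 50.
  by exists ((excess a).-1 %/ 6); move: a3; rewrite /excess; lia.
pose u i := (2 * n + 1) %/ 3 + 1 + i.
pose v i := 2 * n + 1 - a - u i.
have uvP i : i < m -> [/\ u i <= n, v i <= n, u i < v i, u i + v i = 2 * n + 1 - a
    & 2 * n + 1 < 3 * u i].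
  by move=> im; move: mE; rewrite /v /u /excess => mE; split; lia.
exists [seq (inord (u i), inord (v i)) | i <- iota 0 m].
have uE i : i < m -> nat_of_ord (inord (u i) : 'I_n.+1) = u i.
  by move=> /uvP[? _ _ _ _]; rewrite inordK.
have vE i : i < m -> nat_of_ord (inord (v i) : 'I_n.+1) = v i.
  by move=> /uvP[_ ? _ _ _]; rewrite inordK.
split.
- apply: uniq_flatten_pairs; first exact: iota_uniq.
  + move=> i j; rewrite !mem_iota /= add0n => im jm /(congr1 (@nat_of_ord _)).
    by rewrite !uE // /u; lia.
  + move=> i j; rewrite !mem_iota /= add0n => im jm /(congr1 (@nat_of_ord _)).
    rewrite !vE //; have [_ _ _ + _] := uvP i im; have [_ _ _ + _] := uvP j jm.
    by rewrite /u; lia.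
  + move=> i j; rewrite !mem_iota /= add0n => im jm.
    apply/eqP => /(congr1 (@nat_of_ord _)); rewrite uE // vE //.
    by have [_ _ + + _] := uvP _ im; have [_ _ + + _] := uvP _ jm; rewrite /u; lia.
- move=> _ /mapP[i + ->] /=; rewrite mem_iota /= add0n => im.
  have [ui vi uv uva u3] := uvP i im.
  rewrite !inE /top_edge uE // vE // -!ltnNge uva; split.
  + by move: mE; lia.
  + by move: mE; lia.
  + by rewrite leq_subr /= subKn //; have := ltn_ord a; lia.
- by rewrite size_map size_iota.
Qed.

(* The integers [n - (i a + r)], [r < a], form a window on which [a] forbids the
   pairs of sum [f - (2i + 1) a]; this matching reverses each window. *)
Lemma window_matching n (a : 'I_n.+1) : 1 < a -> 3 * a <= n.+1 ->
  exists s : seq ('I_n.+1 * 'I_n.+1),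
  [/\ uniq (flatten [seq [:: p.1; p.2] | p <- s]),
      forall p, p \in s -> [/\ p.1 \in ~: low a, p.2 \in ~: low a & top_edge a p.1 p.2]
    & excess a <= 50 * size s + 50].
Proof.
move=> a1 na.
(* The windows cover the top [I * a] integers: at most about a third of the range, hence above
   [f/3], and at least about a sixth, so that the matching is linear in [n]. *)
have [I Ia nI] : exists2 I, 3 * (I * a) <= n.+1 & n.+1 < 6 * (I * a).
  exists (n.+1 %/ (3 * a)); first by rewrite mulnCA leq_divM.
  have a0 : 0 < 3 * a by lia.
  have I1 : 0 < n.+1 %/ (3 * a) by rewrite divn_gt0.
  have := ltn_ceil n.+1 a0; move: I1; move: (_ %/ _) => I; nia.
(* Only the first half of each window is used, so no pair is listed twice; [a <= 3 * h] relies on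
   [1 < a]. *)
have [h h2 h3] : exists2 h, 2 * h <= a & a <= 3 * h by exists (a %/ 2); lia.
pose J := [seq (i, r) | i <- iota 0 I, r <- iota 0 h].
have JP x : x \in J -> x.1 < I /\ x.2 < h.
  by move=> /allpairsP[[i r] [/= + + ->]]; rewrite !mem_iota /=; lia.
pose u (x : nat * nat) := n - (x.1 * a + x.2).
pose v (x : nat * nat) := n - (x.1 * a + (a - 1 - x.2)).
have uvP x : x \in J -> [/\ x.1 * a + x.2 < I * a, x.1 * a + (a - 1 - x.2) < I * a,
   x.2 < a & a - 1 - x.2 < a].
  by move=> /JP[? ?]; split; nia.
have uE x : nat_of_ord (inord (u x) : 'I_n.+1) = u x by rewrite inordK // /u; lia.
have vE x : nat_of_ord (inord (v x) : 'I_n.+1) = v x by rewrite inordK // /v; lia.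
have dm i r : r < a -> (i * a + r) %/ a = i /\ (i * a + r) %% a = r.
  by move=> ra; rewrite divnMDl ?modnMDl ?divn_small ?modn_small ?addn0 //; lia.
exists [seq (inord (u x), inord (v x)) | x <- J]; split.
- apply: uniq_flatten_pairs.
  + by apply: allpairs_uniq; rewrite ?iota_uniq // => -[? ?] [? ?] _ _ [-> ->].
  + move=> [i r] [j q] iJ jJ /(congr1 (@nat_of_ord _)); rewrite !uE /u /=.
    have [/= i1 i2 i3 i4] := uvP _ iJ; have [/= j1 j2 j3 j4] := uvP _ jJ => E.
    have {}E : i * a + r = j * a + q by lia.
    have [d1 m1] := dm i r i3; have [d2 m2] := dm j q j3.
    have -> : i = j by rewrite -d1 E.
    by have -> : r = q by rewrite -m1 E.
  + move=> [i r] [j q] iJ jJ /(congr1 (@nat_of_ord _)); rewrite !vE /v /=.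
    have [/= i1 i2 i3 i4] := uvP _ iJ; have [/= j1 j2 j3 j4] := uvP _ jJ => E.
    have {}E : i * a + (a - 1 - r) = j * a + (a - 1 - q) by lia.
    have [d1 m1] := dm i _ i4; have [d2 m2] := dm j _ j4.
    have ij : i = j by rewrite -d1 E d2.
    have rq : a - 1 - r = a - 1 - q by rewrite -m1 E m2.
    by congr (_, _) => //; lia.
  + move=> [i r] [j q] iJ jJ; apply/eqP => /(congr1 (@nat_of_ord _)).
    rewrite uE vE /u /v /=.
    have [/= i1 i2 i3 i4] := uvP _ iJ; have [/= j1 j2 j3 j4] := uvP _ jJ => E.
    have {}E : i * a + r = j * a + (a - 1 - q) by lia.
    have [d1 m1] := dm i _ i3; have [d2 m2] := dm j _ j4.
    have rq : r = a - 1 - q by rewrite -m1 E m2.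
    by have [/= _ +] := JP _ iJ; have [/= _ +] := JP _ jJ; lia.
- move=> _ /mapP[[i r] xJ ->] /=; have [/= x1 x2 x3 x4] := uvP _ xJ.
  have fE : 2 * n + 1 - (u (i, r) + v (i, r)) = (2 * i + 1) * a.
    by move: x1 x2 x3 x4 Ia; rewrite /v /u mulnDl mul1n -mulnA /=; lia.
  by rewrite !inE /top_edge uE vE -!ltnNge fE dvdn_mull // andbT /excess /v /u;
    split; move: x1 x2 => /=; lia.
- rewrite size_map size_allpairs !size_iota /excess.
  by nia.
Qed.

Local Open Scope ring_scope.

(** The integers that are not low exceed [f/6] in number by about [s/192], but the matching gains
    [2/5] per edge, at least about [s/125] in the exponent. The difference pays for [s/1000] in
    [target] and for the polynomially many low traces. *)
Lemma poor_count (R : realType) (k : nat) :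
  exists2 C : R, 0 < C & forall n (a : 'I_n.+1), (3 * a < 2 * n + 1)%N ->
  #|[set A in min_family a | (#|A :&: low a| <= k)%N]|%:R <= C * target R a.
Proof.
have [C0 C00 HC] := @poly_le_pow2 R k (1 / 1000) ltac:(lra).
exists (C0 * 2); first by rewrite mulr_gt0.
move=> n a a3; set F := [set A in _ | _].
have [->|[A0]] := set_0Vmem F.
  by rewrite cards0 mulr_ge0 ?powR_ge0 // mulr_ge0 // ltW.
rewrite inE => /andP[/min_familyP[vA0 aA0 _] _].
have [s [us sP ssz]] : exists s : seq ('I_n.+1 * 'I_n.+1),
  [/\ uniq (flatten [seq [:: p.1; p.2] | p <- s]),
      forall p, p \in s -> [/\ p.1 \in ~: low a, p.2 \in ~: low a & top_edge a p.1 p.2]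
    & (excess a <= 50 * size s + 50)%N].
  case: (leqP n.+2 (3 * a)) => na; first exact: middle_matching.
  apply: window_matching => //.
  (* [a = 1] is impossible, since 1 divides [f - 2 * a]. *)
  have a0 := valid_gt0 vA0 aA0; have := valid_dvd_neq vA0 aA0 aA0 aA0.
  by case: (nat_of_ord a) a0 => [|[|]] //; rewrite dvd1n.
have M := @ind_matching_pow2 R _ (top_edge a) s (~: low a) us sP.
set Q := [set t in low a | (a <= t)%N].
have cQ : (#|Q| <= excess a)%N by exact: card_low_from.
have cF : (#|F| <= (#|Q|).+1 ^ k * ind (top_edge a) (~: low a))%N.
  apply: (card_low_high (e := fun=> top_edge a) (H := fun=> ~: low a)) => A.
  rewrite inE => /andP[/min_familyP[vA aA mA] Ak].
  have AQ : A :&: Q = A :&: low a.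
    apply/setP => x; rewrite !inE; case xA: (x \in A) => //=.
    by rewrite mA ?andbT.
  rewrite AQ; split => //.
    apply/fintype.subsetP => x; rewrite !inE => /andP[+ xA].
    by rewrite mA // andbT.
  apply/indepP => x y; rewrite !inE => /andP[_ xA] /andP[_ yA] _.
  by rewrite /top_edge negb_and (valid_dvd_neq vA xA yA aA) orbT.
apply: (@le_trans _ _ (((#|Q|).+1 ^ k)%:R * (ind (top_edge a) (~: low a))%:R)).
  by rewrite -natrM ler_nat.
rewrite mulrAC -mulrA.
apply: (@le_trans _ _ ((C0 * 2 `^ (1 / 1000 * (excess a)%:R)) *
    2 `^ (#|~: low a|%:R - 2 / 5 * (size s)%:R))).
  apply: ler_pM => //.
  apply: le_trans (HC _); rewrite natrX lerXn2r ?nnegrE // ler_nat.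
  by rewrite ltnS; apply: leq_trans cQ _.
rewrite -[leLHS]mulrA ler_wpM2l ?(ltW C00) // /target.
rewrite -[X in _ <= _ * X](@powRr1 R 2) // -!pow2D; apply: pow2_le.
have H1 : 192 * #|~: low a|%:R <= 32 * (2 * n + 1)%:R + 96 + (excess a)%:R :> R.
  by rewrite -!natrM -!natrD ler_nat card_high.
have H2 : (excess a)%:R <= 50 * (size s)%:R + 50 :> R.
  by rewrite -!natrM -!natrD ler_nat.
by move: (ler0n R (excess a)) => H3; lra.
Qed.

Local Close Scope ring_scope.

(** * Sets with many low elements *)

(** Double counting of the pairs [P t y]: some [t] does no worse than the average. *)
Lemma averaging (S V : finType) (T : {set S}) (U : {set V}) (P : S -> V -> bool)
    (D : nat) :
  0 < #|T| -> (forall y, y \in U -> #|[set t in T | P t y]| <= D) ->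
  exists2 t, t \in T & #|T| * #|[set y in U | P t y]| <= D * #|U|.
Proof.
move=> T0 H; apply/exists_inP; apply: contraT.
rewrite negb_exists_in => /forall_inP gt.
have : \sum_(t in T) #|T| * #|[set y in U | P t y]| <= #|T| * (D * #|U|).
  rewrite -big_distrr leq_mul2l /=; apply/orP; right.
  have -> : \sum_(t in T) #|[set y in U | P t y]| =
      \sum_(y in U) #|[set t in T | P t y]|.
    under eq_bigr do rewrite -sum1dep_card big_mkcondr.
    rewrite exchange_big /=; apply: eq_bigr => y _.
    by rewrite -sum1dep_card big_mkcondr.
  by rewrite mulnC -sum_nat_const; apply: leq_sum.
have : \sum_(t in T) (D * #|U|).+1 <= \sum_(t in T) #|T| * #|[set y in U | P t y]|.
  by apply: leq_sum => t /gt; rewrite -ltnNge.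
rewrite sum_nat_const; nia.
Qed.

Definition reflect_edge n (T : {set 'I_n.+1}) : rel 'I_n.+1 :=
  fun y z => [exists t in T, y + z + t == 2 * n + 1].

Lemma low_le n (a t : 'I_n.+1) : 3 * a < 2 * n + 1 -> t \in low a ->
  excess a + 192 * t <= 64 * (2 * n + 1).
Proof. by move=> a3; rewrite inE /excess; lia. Qed.

(* When [2a > n], the elements beyond the middle lie on no edge. *)
Definition middle n (a : 'I_n.+1) := [set x : 'I_n.+1 | a <= x <= 2 * n + 1 - 2 * a].

Lemma card_middle n (a : 'I_n.+1) : #|middle a| <= (excess a).+1.
Proof. by apply: (@card_le_range _ _ a) => y; rewrite inE /excess; lia. Qed.

Lemma ind_middle n (a : 'I_n.+1) (e : rel 'I_n.+1) : 3 * a < 2 * n + 1 ->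
  ind e [set x : 'I_n.+1 | a <= x] <= 2 ^ (2 * a - n - 1) * ind e (middle a).
Proof.
move=> a3; pose L := [set x : 'I_n.+1 | 2 * n + 1 - 2 * a < x].
have -> : [set x : 'I_n.+1 | a <= x] = L :|: middle a.
  by apply/setP => x; rewrite !inE; lia.
apply: leq_trans (ind_free _ _ _) _.
rewrite leq_mul2r leq_exp2l //; apply/orP; right.
apply: (@card_le_range _ _ (2 * n + 1 - 2 * a).+1) => x; rewrite inE.
by have := ltn_ord x; lia.
Qed.

(* [U] and its image under [y -> f - t - y] overlap little and both lie in an
   interval of length about [f + t - 4a]. *)
Lemma reflect_low_degree n (a : 'I_n.+1) (T U : {set 'I_n.+1}) (D : nat) :
  3 * a < 2 * n + 1 -> n < 2 * a -> 0 < #|T| ->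
  (forall t, t \in T -> (t \in low a) && (a <= t)) ->
  (forall y, y \in U -> a <= y <= 2 * n + 1 - 2 * a) ->
  (forall y, y \in U -> #|nbrs (reflect_edge T) U y| < D) ->
  exists2 t, t \in T &
    2 * #|U| + 4 * a <= 2 * n + 2 + t + (D * (excess a).+1) %/ #|T|.
Proof.
move=> a3 na T0 Tlow UV deg.
pose P (t y : 'I_n.+1) := [exists z in U, val z == 2 * n + 1 - t - y].
have Tn t : t \in T -> 3 * t < 2 * n + 1.
  by move=> /Tlow; rewrite inE /excess; lia.
have [|t tT tD] := @averaging _ _ T U P D T0.
  move=> y yU; apply: leq_trans (deg y yU).
  pose h (t : 'I_n.+1) : 'I_n.+1 := inord (2 * n + 1 - t - y).
  have hE t : t \in [set t in T | P t y] -> [/\ t \in T, h t \in U &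
      h t = 2 * n + 1 - t - y :> nat].
    rewrite inE => /andP[tT /exists_inP[z zU /eqP zE]].
    by rewrite /h -zE inord_val.
  rewrite -[leqLHS](card_in_imset (f := h)).
    (* The reflection may fix [y], which is no neighbour of itself; the strict degree bound absorbs
       this extra point. *)
    apply: (@leq_trans #|y |: nbrs (reflect_edge T) U y|); last first.
      by rewrite cardsU1; case: (_ \notin _).
    apply/subset_leq_card/fintype.subsetP => _ /imsetP[t /hE[tT hU htE] ->].
    rewrite !inE hU /=; case: eqP => //= _.
    apply/exists_inP; exists t => //; rewrite htE.
    by have := Tn _ tT; have := UV y yU; lia.
  move=> t u /hE[tT _ htE] /hE[uT _ huE] E; apply/val_inj.
  have : h t = h u :> nat by rewrite E.
  by rewrite htE huE; have := Tn _ tT; have := Tn _ uT; have := UV y yU => /=; lia.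
exists t => //.
have /andP[tl ta] := Tlow t tT.
have t3 := Tn t tT.
have cU : #|U| <= (excess a).+1.
  by apply: (@card_le_range _ _ a) => y /UV; rewrite /excess; lia.
(* Since [a <= t], both [[a, f - 2a]] and its reflection [[2a - t, f - t - a]] lie in
   [[2a - t, f - 2a]]. *)
have := @card_reflection _ U (fun y => 2 * n + 1 - t - y)
   (iota (2 * a - t) (2 * n + 2 + t - 4 * a)).
rewrite size_iota => H.
suff : 2 * #|U| <= 2 * n + 2 + t - 4 * a + D * (excess a).+1 %/ #|T|.
  by move: (_ %/ _) => q; lia.
apply: (leq_trans (H _ _)) => [x y xU yU E|y yU|].
- apply/val_inj; move: E; have := UV _ xU; have := UV _ yU => /=; lia.
- by rewrite !mem_iota; have /= := UV _ yU; lia.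
- rewrite leq_add2l leq_divRL // mulnC; apply: leq_trans tD _.
  by rewrite leq_mul2l cU orbT.
Qed.

Local Open Scope ring_scope.

Lemma nat_bound (R : realType) (M : R) : 0 <= M ->
  exists2 m : nat, m%:R <= M & forall x : nat, x%:R <= M -> (x <= m)%N.
Proof.
move=> M0; exists (Num.truncn M); first by rewrite truncn_le.
by move=> x xM; rewrite truncn_ge_nat.
Qed.

(** The slack between [s/700] and [s/1000] absorbs the number [P] of choices, polynomial in [s]. *)
Lemma target_intro (R : realType) (k : nat) (c : R) :
  exists2 C : R, 0 < C & forall n (a : 'I_n.+1) (P : nat) (M N : R),
    N <= P%:R * M -> (P <= (excess a).+2 ^ k)%N ->
    M <= 2 `^ ((2 * n + 1)%:R / 6 - (excess a)%:R / 700 + c) -> N <= C * target R a.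
Proof.
have [C0 C00 HC] := @poly_le_pow2 R k (1 / 4000) ltac:(lra).
exists (C0 * 2 `^ c); first by rewrite mulr_gt0 // pow2_gt0.
move=> n a P M N NPM Pk HM; apply: (le_trans NPM).
have HP : P%:R <= C0 * 2 `^ (1 / 4000 * (excess a)%:R).
  by apply: le_trans (HC _); rewrite -natrX ler_nat.
apply: (le_trans (ler_wpM2l (ler0n _ _) HM)).
apply: (le_trans (ler_wpM2r (powR_ge0 _ _) HP)).
rewrite -!mulrA ler_wpM2l ?(ltW C00) // /target -!pow2D; apply: pow2_le.
by have : 0 <= (excess a)%:R :> R by []; lra.
Qed.

(** As [2a > n], four elements already exceed [f], so three-term sums are the ones to exploit. The
    choice is a set [T] of [k] low elements of [A]; being low, the reflecting [t] saves [s/384]. *)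
Lemma rich_large_count (R : realType) :
  exists k : nat, exists2 C : R, 0 < C & forall n (a : 'I_n.+1),
  (3 * a < 2 * n + 1)%N -> (n < 2 * a)%N ->
  #|[set A in min_family a | (k <= #|A :&: low a|)%N]|%:R <= C * target R a.
Proof.
have d0 : 0 < 1 / 4000 :> R by lra.
have [D HD] := base_exists d0.
have [k k0 kD] : exists2 k, (0 < k)%N & D%:R <= k%:R / 2000 :> R.
  by exists (2000 * D).+1; rewrite // -[X in X / _]natr1 natrM; lra.
have [C C0 HC] := target_intro k (1 : R).
exists k; exists C => //; move=> n a a3 na.
set F := [set A in _ | _].
set Q := [set t in low a | (a <= t)%N].
have cQ : (#|Q| <= excess a)%N by exact: card_low_from.
have H3' : (2 * a - n - 1 + n + 1 = 2 * a)%N by lia.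
pose W := [set x : 'I_n.+1 | (a <= x)%N].
pose Y := [set T : {set 'I_n.+1} | (T \subset Q) && (#|T| == k)].
(* Half the bound of [reflect_low_degree], with [t <= f/3 - s/192]. The last term cancels against
   the free elements beyond [middle]. *)
pose B : R := (2 * n + 1)%:R / 6 - (excess a)%:R / 384 + ((excess a)%:R + 1) / 4000
   - (2 * a - n - 1)%N%:R.
pose M : R := 2 `^ ((2 * a - n - 1)%N%:R) * (2 `^ B * (2 `^ (1 / 4000)) ^+ (excess a).+1).
have cY : (#|Y| <= (excess a).+2 ^ k)%N.
  apply: (@leq_trans ((#|Q|).+1 ^ k)).
    apply: leq_trans (card_small_subsets Q k); apply/subset_leq_card.
    by apply/fintype.subsetP => T; rewrite !inE => /andP[-> /eqP ->]; rewrite leqnn.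
  by rewrite leq_exp2r // ltnS leqW.
have kk : (D * (excess a).+1)%:R <= k%:R * (((excess a)%:R + 1) / 2000) :> R.
  rewrite natrM -[X in _ * X]natr1 mulrA [X in _ <= X]mulrAC.
  by rewrite ler_wpM2r // addr_ge0.
have MT T : T \in Y -> (ind (reflect_edge T) W)%:R <= M.
  rewrite inE => /andP[/fintype.subsetP TQ /eqP Tk].
  apply: (@le_trans _ _ ((2 ^ (2 * a - n - 1))%:R * (ind (reflect_edge T) (middle a))%:R)).
    by rewrite -natrM ler_nat ind_middle.
  rewrite pow2_nat /M ler_wpM2l ?powR_ge0 //.
  have b1 : 1 <= 2 `^ (1 / 4000) :> R by rewrite ltW // pow2_gt1.
  apply: le_trans (ind_le_of_low_degree (B := B) b1 HD _) _; last first.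
    by rewrite ler_wpM2l ?powR_ge0 // ler_weXn2l // card_middle.
  move=> U /fintype.subsetP UV deg.
  have [|||t tT] := @reflect_low_degree n a T U D a3 na _ _ _ deg.
  - by rewrite Tk.
  - by move=> t /TQ; rewrite inE.
  - by move=> y /UV; rewrite inE.
  have := TQ t tT; rewrite Tk !inE => /andP[tl ta].
  set q := (_ %/ k)%N; move=> H.
  have Hq : q%:R <= ((excess a)%:R + 1) / 2000 :> R.
    rewrite -(@ler_pM2l _ k%:R) ?ltr0n //; apply: le_trans kk.
    by rewrite -natrM ler_nat mulnC leq_divM.
  have H1 : 2 * #|U|%:R + 4 * a%:R <= 2 * n%:R + 2 + t%:R + q%:R :> R.
    by rewrite -!natrM -!natrD ler_nat.
  have H2 : (excess a)%:R + 192 * t%:R <= 64 * (2 * n + 1)%:R :> R.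
    by rewrite -!natrM -!natrD ler_nat low_le // inE.
  have H3 : (2 * a - n - 1)%N%:R + n%:R + 1 = 2 * a%:R :> R.
    by rewrite -natrM -[in RHS]H3' !natrD.
  have H4 : (2 * n + 1)%:R = 2 * n%:R + 1 :> R by rewrite natrD natrM.
  by rewrite /B; lra.
apply: (HC n a #|Y| M) => //.
- have [|m mM Mm] := @nat_bound R M.
    by rewrite /M !mulr_ge0 ?powR_ge0 // exprn_ge0 ?powR_ge0.
  apply: (@le_trans _ _ (#|Y|%:R * m%:R)); last by rewrite ler_wpM2l.
  rewrite -natrM ler_nat; apply: (card_cover
    (G := fun T => [set A : {set 'I_n.+1} | (A \subset W) && indep (reflect_edge T) A])).
    + move=> A; rewrite inE => /andP[/min_familyP[vA aA mA]].
      move=> /card_geqP[s [us ss sA]].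
      exists [set x in s].
        rewrite inE; apply/andP; split.
          apply/fintype.subsetP => x; rewrite !inE => /sA.
          by rewrite !inE => /andP[xA ->]; rewrite mA.
        by rewrite cardsE (card_uniqP us) ss.
      rewrite inE; apply/andP; split.
        by apply/fintype.subsetP => x xA; rewrite inE mA.
      apply/indepP => x y xA yA _; apply/negP => /exists_inP[t].
      rewrite inE => /sA; rewrite inE => /andP[tA _] /eqP.
      have := @valid_sum_neq n A vA x y t ord0 t 0%N xA yA (or_introl tA) (or_intror erefl) tA.
      by rewrite mul0n !addn0.
    + by move=> T TY; apply: Mm; exact: MT.
- rewrite /M -powR_mulrn ?powR_ge0 // -powRrM -!pow2D /B; apply: pow2_le.
  have : 0 <= (excess a)%:R :> R by [].
  by rewrite -natr1; lra.
Qed.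

Local Close Scope ring_scope.

(** * Many small elements: differences within residue classes *)

Definition shift_edge n (T : {set 'I_n.+1}) : rel 'I_n.+1 :=
  fun y z => [exists t in T, (y + t == z) || (z + t == y)].

Definition residue_closed n (a : 'I_n.+1) (T : {set 'I_n.+1}) (X : {set 'I_a}) :=
  [set y : 'I_n.+1 | (y %% a \in [seq val i | i in X]) &&
    [forall t in T, (y + t) %% a \in [seq val i | i in X]]].

(* [U] and [U + t] overlap little, and both lie in the at most [a/2] residue
   classes of [X]; hence [U] has at most about [n/4] elements. *)
Lemma shift_low_degree n (a : 'I_n.+1) (T U : {set 'I_n.+1}) (X : {set 'I_a})
    (h D : nat) :
  0 < a -> 0 < #|T| -> (forall t, t \in T -> 0 < t <= h) -> 2 * #|X| <= a ->
  U \subset residue_closed T X ->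
  (forall y, y \in U -> #|nbrs (shift_edge T) U y| < D) ->
  4 * #|U| <= n.+1 + h + a + 2 * ((D * n.+1) %/ #|T|).
Proof.
move=> a0 T0 Th Xa /fintype.subsetP UV deg.
pose P (t y : 'I_n.+1) := [exists z in U, val z == y + t].
have [|t tT tD] := @averaging _ _ T U P D T0.
  move=> y yU; apply: leq_trans (ltnW (deg y yU)).
  pose h' (t : 'I_n.+1) : 'I_n.+1 := inord (y + t).
  have hE t : t \in [set t in T | P t y] -> [/\ t \in T, h' t \in U &
      h' t = y + t :> nat].
    rewrite inE => /andP[tT /exists_inP[z zU /eqP zE]].
    by rewrite /h' -zE inord_val.
  rewrite -[leqLHS](card_in_imset (f := h')).
    apply/subset_leq_card/fintype.subsetP => _ /imsetP[t /hE[tT hU htE] ->].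
    rewrite !inE hU /=; apply/andP; split.
      apply/eqP => /(congr1 (@nat_of_ord _)); rewrite htE.
      by have := Th t tT; lia.
    by apply/exists_inP; exists t => //; rewrite htE eqxx.
  move=> t u /hE[tT _ htE] /hE[uT _ huE] E; apply/val_inj.
  have : h' t = h' u :> nat by rewrite E.
  by rewrite htE huE => /=; lia.
pose r := [seq y <- iota 0 (n + h).+1 | y %% a \in [seq val i | i in X]].
have th := Th t tT.
have H : 2 * #|U| <= size r + #|[set y in U | [exists z in U, \val z == y + t]]|.
  apply: (@card_reflection _ U (fun y => y + t)) => [x y xU yU E|y yU].
    by apply/val_inj; move: E => /=; lia.
  have := UV y yU; rewrite inE => /andP[yX /forall_inP/(_ t tT) ytX].
  rewrite !mem_filter yX ytX !mem_iota /=.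
  by have := ltn_ord y; lia.
have sr : 2 * size r <= n + h + 1 + a.
  apply: leq_trans (leq_mul (leqnn 2) (size_filter_residues _ X a0)) _.
  rewrite mulnA; apply: leq_trans (leq_mul Xa (leqnn _)) _.
  by rewrite mulnS mulnC addnC leq_add2r addn1 leq_divM.
have : #|[set y in U | [exists z in U, \val z == y + t]]| <= D * n.+1 %/ #|T|.
  rewrite leq_divRL // mulnC; apply: leq_trans tD _.
  by rewrite leq_mul2l -[X in _ <= X]card_ord max_card orbT.
by move: (_ %/ _) H sr => q; move: (size r) => m; lia.
Qed.

Definition small n := [set x : 'I_n.+1 | 0 < x <= n %/ 40].

(* [X] collects the residues modulo [a] of [A] and [A + T].  Only elements of [A]
   up to [n - n/40] are used, so that four-term sums stay below [f]. *)
Lemma valid_residues n (a : 'I_n.+1) (A T : {set 'I_n.+1}) :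
  A \in min_family a -> T \subset A :&: small n ->
  exists X : {set 'I_a}, 2 * #|X| <= a /\
    A \subset [set x : 'I_n.+1 | n - n %/ 40 < x] :|: residue_closed T X.
Proof.
move=> /min_familyP[vA aA _] /fintype.subsetP TA.
have a0 : 0 < a := valid_gt0 vA aA.
(* Adjoining 0 to [T] puts the residues of [A] and of [A + T] into [X] at once. *)
pose T0 (s : 'I_n.+1) := (s \in T) || (s == ord0).
pose X : {set 'I_a} := [set i : 'I_a | [exists y in A, (y <= n - n %/ 40) &&
  [exists s, T0 s && (val i == (y + s) %% a)]]].
have T0P s : T0 s -> (s \in A \/ s = 0 :> nat) /\ s <= n %/ 40.
  case/orP => [/TA|/eqP->]; last by split; [right|].
  by rewrite !inE => /and3P[-> _ ->]; split; [left|].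
exists X; split.
  apply: (@card_sum_avoiding _ (2 * n + 1)) => i j; rewrite !inE.
  move=> /exists_inP[y yA /andP[yn /existsP[s /andP[/T0P[sA sn] /eqP ->]]]].
  move=> /exists_inP[z zA /andP[zn /existsP[t /andP[/T0P[tA tn] /eqP ->]]]].
  apply/negP; rewrite modnDm => /eqP E.
  have le : y + s + (z + t) <= 2 * n + 1 by lia.
  have /dvdnP[q qE] : a %| 2 * n + 1 - (y + s + (z + t)).
    by rewrite -eqn_mod_dvd // E.
  by have := @valid_sum_neq n A vA y z s t a q yA zA sA tA aA; move: qE le; lia.
have XP y s : y \in A -> y <= n - n %/ 40 -> T0 s ->
    (y + s) %% a \in [seq val i | i in X].
  move=> yA yn Ts; have lt : (y + s) %% a < a by rewrite ltn_pmod.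
  apply/imageP; exists (Ordinal lt) => //; rewrite inE.
  apply/exists_inP; exists y => //; rewrite yn /=.
  by apply/existsP; exists s; rewrite Ts /=.
apply/fintype.subsetP => y yA; rewrite !inE; case: ltnP => //= yn.
apply/andP; split.
  by have := XP y ord0 yA yn; rewrite /T0 eqxx orbT addn0; apply.
by apply/forall_inP => t tT; apply: XP => //; rewrite /T0 tT.
Qed.

Lemma ind_top n (e : rel 'I_n.+1) (V : {set 'I_n.+1}) (h : nat) :
  ind e ([set x : 'I_n.+1 | n - h < x] :|: V) <= 2 ^ h * ind e V.
Proof.
apply: leq_trans (ind_free _ _ _) _.
rewrite leq_mul2r leq_exp2l //; apply/orP; right.
apply: (@card_le_range _ _ (n - h).+1) => x; rewrite inE.
by have := ltn_ord x; lia.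
Qed.

(** For [2a <= n] the excess is above [n/2], so factors polynomial in [n] are polynomial in [s], as
    [target_intro] requires. *)
Lemma le_excess_sq n (a : 'I_n.+1) : 2 * a <= n -> n.+2 <= (excess a).+2 ^ 2.
Proof. by rewrite /excess => an; rewrite expnS expn1; nia. Qed.

Lemma excess_le n (a : 'I_n.+1) : excess a <= 2 * n.+1.
Proof. by rewrite /excess; lia. Qed.

Lemma le_excess n (a : 'I_n.+1) : 2 * a <= n -> n < 2 * excess a.
Proof. by rewrite /excess; lia. Qed.

Local Open Scope ring_scope.

(** The choices are [k] small elements and the residue set [X]. The containers have little more than
    [n/4] elements, so the saving over [n/3] is linear in [n] and outweighs all other factors. *)
Lemma rich_small_count (R : realType) :
  exists k : nat, exists2 C : R, 0 < C & forall n (a : 'I_n.+1),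
  (2 * a <= n)%N ->
  #|[set A in min_family a | (k <= #|A :&: small n|)%N]|%:R <= C * target R a.
Proof.
have d0 : 0 < 1 / 4000 :> R by lra.
have [D HD] := base_exists d0.
have [k k0 kD] : exists2 k, (0 < k)%N & D%:R <= k%:R / 2000 :> R.
  by exists (2000 * D).+1; rewrite // -[X in X / _]natr1 natrM; lra.
have [C C0 HC] := target_intro (2 * k) (2 : R).
exists k; exists C => //; move=> n a an.
set F := [set A in _ | _].
have cS : (#|small n| <= n)%N.
  by apply: (@card_le_range _ _ 1) => x; rewrite inE add1n ltn_ord => /andP[->].
have [->|[A0]] := set_0Vmem F.
  by rewrite cards0 mulr_ge0 ?powR_ge0 // ltW.
rewrite inE => /andP[/min_familyP[vA0 aA0 mA0] /(leq_trans k0)].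
(* A small element bounds the minimum: [a <= n/40], hence at most [2^(n/40)] sets [X]. *)
rewrite card_gt0 => /set0Pn[t0]; rewrite !inE => /and3P[t0A _ t0n].
have a0 := valid_gt0 vA0 aA0.
have ah : (a <= n %/ 40)%N := leq_trans (mA0 _ t0A) t0n.
pose YT := [set T : {set 'I_n.+1} | (T \subset small n) && (#|T| == k)].
pose Y := setX YT [set X : {set 'I_a} | (2 * #|X| <= a)%N].
pose top := [set x : 'I_n.+1 | (n - n %/ 40 < x)%N].
pose V (p : {set 'I_n.+1} * {set 'I_a}) := top :|: residue_closed p.1 p.2.
pose h : R := (n %/ 40)%:R.
pose B : R := (n%:R + 2 * h + 1) / 4 + (n%:R + 1) / 4000.
pose M : R := 2 `^ h * (2 `^ B * (2 `^ (1 / 4000)) ^+ n.+1).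
have cYT : (#|YT| <= n.+2 ^ k)%N.
  apply: (@leq_trans ((#|small n|).+1 ^ k)).
    apply: leq_trans (card_small_subsets (small n) k); apply/subset_leq_card.
    by apply/fintype.subsetP => T; rewrite !inE => /andP[-> /eqP ->]; rewrite leqnn.
  by rewrite leq_exp2r // ltnS leqW.
have cY : (#|Y| <= n.+2 ^ k * 2 ^ (n %/ 40))%N.
  rewrite cardsX; apply: leq_mul => //.
  apply: (@leq_trans #|powerset [set: 'I_a]|).
    by apply/subset_leq_card/fintype.subsetP => X _; rewrite powersetE finset.subsetT.
  by rewrite card_powerset cardsT card_ord leq_exp2l.
have kk : (D * n.+1)%:R <= k%:R * ((n%:R + 1) / 2000) :> R.
  rewrite natrM -[X in _ * X]natr1 mulrA [X in _ <= X]mulrAC.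
  by rewrite ler_wpM2r // addr_ge0.
have MT p : p \in Y -> (ind (shift_edge p.1) (V p))%:R <= M.
  case: p => T X; rewrite !inE /= => /andP[/andP[/fintype.subsetP TQ /eqP Tk] Xa].
  apply: (@le_trans _ _ ((2 ^ (n %/ 40))%:R * (ind (shift_edge T) (residue_closed T X))%:R)).
    by rewrite -natrM ler_nat ind_top.
  rewrite pow2_nat /M ler_wpM2l ?powR_ge0 //.
  have b1 : 1 <= 2 `^ (1 / 4000) :> R by rewrite ltW // pow2_gt1.
  apply: le_trans (ind_le_of_low_degree (B := B) b1 HD _) _; last first.
    rewrite ler_wpM2l ?powR_ge0 // ler_weXn2l //.
    by rewrite -[X in (_ <= X)%N]card_ord max_card.
  move=> U UV deg.
  have := @shift_low_degree n a T U X (n %/ 40) D a0 _ _ Xa UV deg.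
  rewrite Tk => /(_ k0 _)H.
  have {}H : (4 * #|U| <= n.+1 + n %/ 40 + a + 2 * (D * n.+1 %/ k))%N.
    by apply: H => t /TQ; rewrite inE.
  have Hq : (D * n.+1 %/ k)%:R <= (n%:R + 1) / 2000 :> R.
    rewrite -(@ler_pM2l _ k%:R) ?ltr0n //; apply: le_trans kk.
    by rewrite -natrM ler_nat mulnC leq_divM.
  have H1 : 4 * #|U|%:R <= n.+1%:R + h + a%:R + 2 * (D * n.+1 %/ k)%:R :> R.
    by rewrite /h -!natrM -!natrD ler_nat.
  rewrite -natr1 in H1.
  have H2 : a%:R <= h by rewrite ler_nat.
  by rewrite /B; lra.
(* This factor [2^h] counts the sets [X]; the one inside [M] frees the top [n/40] integers. *)
apply: (HC n a (n.+2 ^ k)%N (2 `^ h * M)) => //.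
- have [|m mM Mm] := @nat_bound R M.
    by rewrite /M !mulr_ge0 ?powR_ge0 // exprn_ge0 ?powR_ge0.
  apply: (@le_trans _ _ (#|Y|%:R * m%:R)); last first.
    apply: (@le_trans _ _ ((n.+2 ^ k * 2 ^ (n %/ 40))%:R * M)).
      by apply: ler_pM => //; rewrite ler_nat.
    by rewrite natrM pow2_nat mulrA.
  rewrite -natrM ler_nat; apply: (card_cover
    (G := fun p => [set A : {set 'I_n.+1} | (A \subset V p) && indep (shift_edge p.1) A])).
  + move=> A; rewrite inE => /andP[mA /card_geqP[s [us ss sA]]].
    have [vA aA _] := min_familyP mA.
    have TA : [set x in s] \subset A :&: small n.
      by apply/fintype.subsetP => x; rewrite inE => /sA.
    have [X [Xa AX]] := valid_residues mA TA.
    exists ([set x in s], X).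
      rewrite !inE /= Xa andbT; apply/andP; split.
        exact: fintype.subset_trans TA (subsetIr _ _).
      by rewrite cardsE (card_uniqP us) ss.
    rewrite inE /= AX; apply/indepP => x y xA yA _.
    apply/negP => /exists_inP[t tT].
    have tA : t \in A by move: (fintype.subsetP TA t tT); rewrite inE => /andP[].
    by case/orP => /eqP; apply: (valid_diff_neq vA).
  + by move=> p pY; apply: Mm; exact: MT.
- by rewrite expnM leq_exp2r // le_excess_sq.
- rewrite /M -powR_mulrn ?powR_ge0 // -powRrM -!pow2D /B; apply: pow2_le.
  have H1 : h * 40 <= n%:R by rewrite /h -natrM ler_nat leq_divM.
  have H2 : (excess a)%:R <= 2 * (n%:R + 1) :> R.
    by rewrite natr1 -natrM ler_nat excess_le.
  have H3 : (2 * n + 1)%:R = 2 * n%:R + 1 :> R by rewrite natrD natrM.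
  have H4 : 0 <= n%:R :> R by [].
  by rewrite -natr1; lra.
Qed.

Local Close Scope ring_scope.

(** * Low elements above n/40: sums and differences together *)

Section ModularEdges.
Variable n : nat.
Implicit Types (t x y z : 'I_n.+1) (T U W : {set 'I_n.+1}).

Definition mod_edge t : rel 'I_n.+1 :=
  fun y z => [|| t %| 2 * n + 1 - (y + z), y + t == z | z + t == y].

Definition mod_edges T : rel 'I_n.+1 := fun y z => [exists t in T, mod_edge t y z].

Lemma mod_edgeC t y z : mod_edge t y z = mod_edge t z y.
Proof. by rewrite /mod_edge [y + z]addnC; congr (_ || _); exact: orbC. Qed.

(* The residues of [W] modulo [t] are distinct, and no two of them add up to
   [f]. *)
Lemma window_bound t W l :
  0 < t -> (forall y, y \in W -> l < y <= l + 2 * t) -> indep (mod_edge t) W ->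
  (forall y, y \in W -> ~~ (t %| 2 * n + 1 - (y + y))) -> 2 * #|W| <= t.
Proof.
move=> t0 Wl /indepP iW loop.
pose h y : 'I_t := Ordinal (ltn_pmod y t0).
have hI : {in W &, injective h}.
  have wlog y z : y \in W -> z \in W -> y < z -> y %% t <> z %% t.
    move=> yW zW yz E; have ne : y != z by rewrite -val_eqE /= ltn_eqF.
    have /negP := iW _ _ yW zW ne; apply.
    have /dvdnP[q qE] : t %| z - y by rewrite -eqn_mod_dvd ?(ltnW yz) // E.
    (* Two congruent elements of a window of length [2 * t] differ by exactly [t], a forbidden
       difference. *)
    have q1 : q = 1.
      have := Wl _ yW; have := Wl _ zW => z2 y2.
      have : 0 < q * t < 2 * t by rewrite -qE; lia.
      by case: q {qE} => [|[|q]] //; nia.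
    by rewrite /mod_edge; apply/or3P/Or32/eqP; move: qE; rewrite q1; lia.
  move=> y z yW zW /(congr1 val) /= E; apply/val_inj.
  by case: (ltngtP y z) => // yz; [case: (wlog y z) | case: (wlog z y)].
rewrite -(card_in_imset hI); apply: (@card_sum_avoiding _ (2 * n + 1)).
move=> _ _ /imsetP[y yW ->] /imsetP[z zW ->] /=.
apply/negP; rewrite modnDm => E.
have d : t %| 2 * n + 1 - (y + z).
  by rewrite -eqn_mod_dvd 1?eq_sym //; have := ltn_ord y; have := ltn_ord z; lia.
have [yz|yz] := eqVneq y z; first by move: (loop _ yW); rewrite {2}yz d.
by move: (iW _ _ yW zW yz); rewrite /mod_edge d.
Qed.

Lemma windows_bound t W l k :
  0 < t -> (forall y, y \in W -> l < y <= l + 2 * t * k) -> indep (mod_edge t) W ->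
  (forall y, y \in W -> ~~ (t %| 2 * n + 1 - (y + y))) -> 2 * #|W| <= k * t.
Proof.
move=> t0; elim: k l W => [|k IH] l W Wl iW loop.
  have -> : W = set0 by apply/setP => y; rewrite inE; apply/negP => /Wl; lia.
  by rewrite cards0.
pose L := [set y : 'I_n.+1 | y <= l + 2 * t].
rewrite -(cardsID L W) mulnDr mulSn leq_add //.
  apply: (window_bound (l := l)) => // [y||y].
  - by rewrite !inE => /andP[/Wl /andP[-> _] ->].
  - exact: indep_sub (subsetIl _ _) iW.
  - by rewrite inE => /andP[/loop].
apply: (IH (l + 2 * t)) => [y||y].
- by rewrite !inE -ltnNge => /andP[-> /Wl]; rewrite mulnS; lia.
- exact: indep_sub (subsetDl _ _) iW.
- by rewrite inE => /andP[_ /loop].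
Qed.

(** If [t >= n/3], one window covers [(t, n]], giving [t/2]. If [3n/10 <= t < n/3], one window and
    the [n - 3t] integers above it give at most [n/4]. For smaller [t], several windows give
    [(n + t)/4], below [0.325 n]. *)
Lemma mod_indep_bound (a : 'I_n.+1) t W :
  2 * a <= n -> t \in low a -> 0 < t -> (forall y, y \in W -> t < y) ->
  indep (mod_edge t) W ->
  (forall y, y \in W -> ~~ (t %| 2 * n + 1 - (y + y))) ->
  384 * #|W| + excess a <= 64 * (2 * n + 1) + 768.
Proof.
move=> an tl t0 Wt iW loop.
have a3 : 3 * a < 2 * n + 1 by lia.
have tle := low_le a3 tl; have ae := excess_le a.
case: (leqP n (3 * t)) => nt.
  have := @windows_bound t W t 1 t0 _ iW loop.
  have H y : y \in W -> t < y <= t + 2 * t * 1.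
    by move=> /Wt ->; have := ltn_ord y; lia.
  by move=> /(_ H); lia.
case: (leqP (3 * n) (10 * t)) => nt'.
  pose L := [set y : 'I_n.+1 | y <= 3 * t].
  have c1 : 2 * #|W :&: L| <= t.
    apply: (window_bound (l := t)) => // [y||y].
    - by rewrite !inE => /andP[/Wt -> ]; lia.
    - exact: indep_sub (subsetIl _ _) iW.
    - by rewrite inE => /andP[/loop].
  have c2 : #|W :\: L| <= n - 3 * t.
    apply: (@card_le_range _ _ (3 * t).+1) => y; rewrite !inE -ltnNge => /andP[-> _].
    by have := ltn_ord y; lia.
  rewrite -(cardsID L W); move: c1 c2; move: #|W :&: L| #|W :\: L| => x y; lia.
set k := ((n - t) %/ (2 * t)).+1.
have kn : n - t < 2 * t * k by rewrite mulnC ltn_ceil // muln_gt0.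
have kt : 2 * (k * t) <= n + t.
  by have := leq_divM (n - t) (2 * t); rewrite /k; move: (_ %/ _) => q; nia.
have H y : y \in W -> t < y <= t + 2 * t * k.
  by move=> /Wt ->; have := ltn_ord y; lia.
have := @windows_bound t W t k t0 H iW loop.
by clearbody k; move: kt; move: (k * t) => z; lia.
Qed.

(** A divisor [t > n/40] of [f - (y + z)] is determined by its quotient, which is below 80; the
    differences [z - y] and [y - z] account for 2 more. *)
Lemma mod_multiplicity T y z :
  (forall t, t \in T -> n %/ 40 < t) -> #|[set t in T | mod_edge t y z]| <= 82.
Proof.
move=> Tn; set w := 2 * n + 1 - (y + z).
have w0 : 0 < w <= 2 * n + 1.
  by rewrite /w; have := ltn_ord y; have := ltn_ord z; lia.
pose T1 := [set t in T | t %| w].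
pose T2 : {set 'I_n.+1} := [set inord (z - y); inord (y - z)].
have sub : [set t in T | mod_edge t y z] \subset T1 :|: T2.
  apply/fintype.subsetP => t; rewrite !inE => /andP[-> /or3P[->//|/eqP E|/eqP E]].
  - by apply/orP; right; rewrite -E addKn inord_val eqxx.
  - by apply/orP; right; rewrite -E addKn inord_val eqxx orbT.
apply: leq_trans (subset_leq_card sub) _.
apply: leq_trans (leq_card_setU _ _) _.
have -> : 82 = 80 + 2 by [].
apply: leq_add; last by rewrite cards2; case: (_ != _).
pose h (t : 'I_n.+1) : 'I_80 := inord (w %/ t).
have hE t : t \in T1 -> (h t = w %/ t :> nat) * (w %/ t * t = w).
  rewrite inE => /andP[/Tn tn td]; split; last by rewrite divnK.
  rewrite inordK // ltn_divLR; last by lia.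
  by move: w0 tn; clearbody w; lia.
rewrite -(card_in_imset (f := h)).
  by apply: leq_trans (max_card _) _; rewrite card_ord.
move=> t u tT uT E; apply/val_inj => /=.
have [t1 t2] := hE _ tT; have [u1 u2] := hE _ uT.
have q : w %/ t = w %/ u by rewrite -t1 -u1 E.
have q0 : 0 < w %/ t.
  by rewrite lt0n; apply: contraTneq w0 => q0; rewrite -t2 q0 mul0n.
by apply/eqP; rewrite -(eqn_pmul2l q0) t2 q u2.
Qed.

Lemma mod_low_degree (a : 'I_n.+1) T U (D : nat) :
  2 * a <= n -> 0 < #|T| -> (forall t, t \in T -> (t \in low a) && (n %/ 40 < t)) ->
  (forall t y, t \in T -> y \in U -> t < y) ->
  (forall t y, t \in T -> y \in U -> ~~ (t %| 2 * n + 1 - (y + y))) ->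
  (forall y, y \in U -> #|nbrs (mod_edges T) U y| < D) ->
  384 * #|U| + excess a <= 64 * (2 * n + 1) + 768 + 384 * ((82 * D * n.+1) %/ #|T|).
Proof.
move=> an T0 Tl TU loop deg.
(* Deleting the larger end of every [t]-edge inside [U] leaves a set independent for [t]. *)
pose P t y := [exists z in U, (z < y) && mod_edge t y z].
have [|t tT tD] := @averaging _ _ T U P (82 * D) T0.
  move=> y yU.
  pose N := nbrs (mod_edges T) U y.
  apply: (@leq_trans (#|N| * 82)); last first.
    by rewrite mulnC leq_mul2l /= ltnW // deg.
  apply: (card_cover (G := fun z => [set t in T | mod_edge t y z])).
    move=> t; rewrite inE => /andP[tT /exists_inP[z zU /andP[zy e]]].
    exists z; last by rewrite inE tT.
    rewrite !inE zU -val_eqE /= ltn_eqF //=; apply/exists_inP.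
    by exists t.
  by move=> z _; apply: mod_multiplicity => t /Tl/andP[].
have /andP[tl tn] := Tl t tT.
pose W := [set y in U | ~~ P t y].
have WU : W \subset U by apply/fintype.subsetP => y; rewrite inE => /andP[].
have H : 384 * #|W| + excess a <= 64 * (2 * n + 1) + 768.
  apply: (@mod_indep_bound a t W an tl (leq_ltn_trans (leq0n _) tn)).
  - by move=> y /(fintype.subsetP WU); exact: TU.
  - apply/indepP => y z; rewrite !inE => /andP[yU nPy] /andP[zU nPz] ne.
    have [yz|zy|/val_inj E] := ltngtP y z; last by rewrite E eqxx in ne.
    + rewrite mod_edgeC; apply: contra nPz => e.
      by apply/exists_inP; exists y => //; rewrite yz.
    + apply: contra nPy => e.
      by apply/exists_inP; exists z => //; rewrite zy.
  - by move=> y /(fintype.subsetP WU); exact: loop.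
have cU : #|U| = #|W| + #|[set y in U | P t y]|.
  rewrite addnC -(cardsID [set y | P t y] U); congr (_ + _); apply: eq_card => y.
    by rewrite !inE.
  by rewrite !inE andbC.
have : #|[set y in U | P t y]| <= (82 * D * n.+1) %/ #|T|.
  rewrite leq_divRL // mulnC; apply: leq_trans tD _.
  by rewrite leq_mul2l -[X in _ <= X]card_ord max_card orbT.
by move: (_ %/ _) => q; move: H; rewrite cU; lia.
Qed.

End ModularEdges.

(** [t] is the [k]-th smallest element of [B], reached by removing maxima. *)
Lemma prefix_exists n (B : {set 'I_n.+1}) k : 0 < k <= #|B| ->
  exists2 t, t \in B & #|B :&: [set x : 'I_n.+1 | x <= t]| = k.
Proof.
have [m] := ubnP #|B|; elim: m B => // m IH B Bm /andP[k0 kB].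
have [x0 x0B] : exists x, x \in B by apply/set0Pn; rewrite -card_gt0; lia.
pose x := [arg max_(i > x0 in B) (i : nat)].
have [xB xmax] : x \in B /\ forall y, y \in B -> y <= x by rewrite /x; case: arg_maxnP.
have [Bk|Bk] := eqVneq #|B| k.
  exists x => //; rewrite -Bk; apply: eq_card => y; rewrite !inE.
  by case yB: (y \in B) => //=; rewrite xmax.
have cB := cardsD1 x B; rewrite xB in cB.
have [||t] := IH (B :\ x); [by lia|by move/eqP: Bk; lia|].
rewrite !inE => /andP[tx tB] <-; exists t => //.
apply: eq_card => y; rewrite !inE; case: eqP => //= ->.
have := xmax _ tB; rewrite leq_eqVlt => /orP[/eqP/val_inj E|lt].
  by rewrite E eqxx in tx.
by rewrite [x <= t]leqNgt lt andbF.
Qed.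

Definition mid n (a : 'I_n.+1) := [set x in low a | n %/ 40 < x].

(** [indep] tests distinct elements only, so doubles [x + x] are excluded here. *)
Definition mod_vertices n (t : 'I_n.+1) (T : {set 'I_n.+1}) :=
  [set x : 'I_n.+1 | (t < x) && [forall s in T, ~~ (s %| 2 * n + 1 - (x + x))]].

(** Everything in [A] up to a low [t] is low as well, hence small or in [mid a]. Outside [Q] the
    elements exceed [t], as the windows need. *)
Lemma mid_prefix n (a t : 'I_n.+1) (A : {set 'I_n.+1}) (Q := [set x : 'I_n.+1 | x <= t]) :
  A \in min_family a -> t \in mid a ->
  [/\ #|A :&: Q| <= #|A :&: small n| + #|A :&: mid a :&: Q|,
      A :\: Q \subset mod_vertices t (A :&: Q :&: mid a) &
      indep (mod_edges (A :&: Q :&: mid a)) (A :\: Q)].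
Proof.
move=> /min_familyP[vA aA mA]; rewrite inE => /andP[tl tn].
split.
- apply: leq_trans (leq_card_setU _ _); apply/subset_leq_card/fintype.subsetP => x.
  rewrite !inE => /andP[xA xt]; rewrite xA xt (valid_gt0 vA xA) /= andbT.
  case: leqP => //= _; rewrite andbT; move: tl; rewrite inE => tl.
  by apply: leq_trans tl _; rewrite leq_mul2l /=; lia.
- apply/fintype.subsetP => x; rewrite !inE -ltnNge => /andP[-> xA] /=.
  apply/forall_inP => s; rewrite !inE => /andP[/andP[sA _] _].
  exact: (valid_dvd_neq vA).
- apply/indepP => x y; rewrite !inE => /andP[_ xA] /andP[_ yA] _.
  apply/negP => /exists_inP[s]; rewrite !inE => /andP[/andP[sA _] _].
  case/or3P => [|/eqP|/eqP]; first by apply/negP; exact: (valid_dvd_neq vA).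
  + exact: (valid_diff_neq vA).
  + exact: (valid_diff_neq vA).
Qed.

Local Open Scope ring_scope.

(** The choices are the [k]-th element [t] of [A] in [mid a] and the trace of [A] up to [t], which
    has at most [k2 + k] elements and contains the set [T] defining the graph. *)
Lemma rich_mid_count (R : realType) (k2 : nat) :
  exists k : nat, exists2 C : R, 0 < C & forall n (a : 'I_n.+1),
  (2 * a <= n)%N ->
  #|[set A in min_family a | (#|A :&: small n| <= k2)%N && (k <= #|A :&: mid a|)%N]|%:R
    <= C * target R a.
Proof.
have d0 : 0 < 1 / 4000 :> R by lra.
have [D HD] := base_exists d0.
have [k k0 kD] : exists2 k, (0 < k)%N & (82 * D)%:R <= k%:R / 4000 :> R.
  by exists (4000 * (82 * D)).+1; rewrite // -[X in X / _]natr1 natrM; lra.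
have [C C0 HC] := target_intro (2 * (k2 + k).+1) (3 : R).
exists k; exists C => //; move=> n a an.
set F := [set A in _ | _].
have na := le_excess an.
pose B : R := (2 * n + 1)%:R / 6 - (excess a)%:R / 384 + 2 + (n%:R + 1) / 4000.
pose M : R := 2 `^ B * (2 `^ (1 / 4000)) ^+ n.+1.
have kk : (82 * D * n.+1)%:R <= k%:R * ((n%:R + 1) / 4000) :> R.
  rewrite natrM -[X in _ * X]natr1 mulrA [X in _ <= X]mulrAC.
  by rewrite ler_wpM2r // addr_ge0.
have [|m mM Mm] := @nat_bound R M.
  by rewrite /M mulr_ge0 ?powR_ge0 // exprn_ge0 ?powR_ge0.
have HM (t : 'I_n.+1) (T : {set 'I_n.+1}) :
    t \in mid a -> T \subset mid a :&: [set x : 'I_n.+1 | (x <= t)%N] ->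
    #|T| = k -> (ind (mod_edges T) (mod_vertices t T) <= m)%N.
  move=> tm /fintype.subsetP TQ Tk; apply: Mm.
  have b1 : 1 <= 2 `^ (1 / 4000) :> R by rewrite ltW // pow2_gt1.
  apply: le_trans (ind_le_of_low_degree (B := B) b1 HD _) _; last first.
    rewrite ler_wpM2l ?powR_ge0 // ler_weXn2l //.
    by rewrite -[X in (_ <= X)%N]card_ord max_card.
  move=> U /fintype.subsetP UV deg.
  have H : (384 * #|U| + excess a <= 64 * (2 * n + 1) + 768 +
      384 * ((82 * D * n.+1) %/ k))%N.
    rewrite -Tk; apply: (@mod_low_degree n a T U D an) => //; first by rewrite Tk.
    - by move=> s /TQ; rewrite !inE => /andP[].
    - move=> s y /TQ; rewrite !inE => /andP[_ st] /UV; rewrite inE => /andP[ty _].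
      exact: leq_ltn_trans st ty.
    - by move=> s y sT /UV; rewrite inE => /andP[_ /forall_inP/(_ s sT)].
  have Hq : (82 * D * n.+1 %/ k)%:R <= (n%:R + 1) / 4000 :> R.
    rewrite -(@ler_pM2l _ k%:R) ?ltr0n //; apply: le_trans kk.
    by rewrite -natrM ler_nat mulnC leq_divM.
  have H1 : 384 * #|U|%:R + (excess a)%:R <= 64 * (2 * n + 1)%:R + 768 +
      384 * (82 * D * n.+1 %/ k)%:R :> R.
    by rewrite -!natrM -!natrD ler_nat.
  by rewrite /B; lra.
have cF : (#|F| <= n.+2 ^ (k2 + k).+1 * m)%N.
  apply: (@leq_trans (#|mid a| * (n.+2 ^ (k2 + k) * m))); last first.
    rewrite expnS -mulnA leq_mul2r; apply/orP; right.
    by apply: leq_trans (max_card _) _; rewrite card_ord.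
  pose G (t : 'I_n.+1) := [set A in min_family a | (#|A :&: small n| <= k2)%N &&
    (#|A :&: mid a :&: [set x : 'I_n.+1 | (x <= t)%N]| == k)].
  apply: (card_cover (G := G)).
    move=> A; rewrite inE => /and3P[mA sA kA].
    have [|t tA tk] := @prefix_exists n (A :&: mid a) k; first by rewrite k0.
    exists t; first by move: tA; rewrite inE => /andP[].
    by rewrite inE mA sA tk eqxx.
  move=> t tm; set Q := [set x : 'I_n.+1 | (x <= t)%N].
  apply: (@leq_trans ((#|Q|).+1 ^ (k2 + k) * m)); last first.
    rewrite leq_mul2r leq_exp2r ?addn_gt0 ?k0 ?orbT // ltnS.
    by apply/orP; right; apply: leq_trans (max_card _) _; rewrite card_ord.
  apply: (card_low_high (e := fun E => mod_edges (E :&: mid a))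
                        (H := fun E => mod_vertices t (E :&: mid a))) => A.
  rewrite inE => /and3P[mA sA /eqP kA].
  have [H1 H2 H3] := mid_prefix mA tm; split => //.
    by apply: leq_trans H1 _; rewrite kA leq_add2r.
  apply: HM => //.
    by apply/fintype.subsetP => x; rewrite !inE => /andP[/andP[_ ->] ->].
  by rewrite -kA finset.setIAC.
apply: (HC n a (n.+2 ^ (k2 + k).+1)%N M) => //.
- by apply: (@le_trans _ _ ((n.+2 ^ (k2 + k).+1)%:R * m%:R));
    rewrite ?ler_wpM2l // -natrM ler_nat.
- by rewrite expnM leq_exp2r // le_excess_sq.
- rewrite /M -powR_mulrn ?powR_ge0 // -powRrM -!pow2D /B; apply: pow2_le.
  have H1 : n%:R + 1 <= 2 * (excess a)%:R :> R by rewrite natr1 -natrM ler_nat.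
  have H2 : 0 <= (excess a)%:R :> R by [].
  by rewrite -natr1; lra.
Qed.

Local Close Scope ring_scope.

(** * Summing over the minimum *)

Local Open Scope ring_scope.

Lemma min_family_count (R : realType) :
  exists2 C : R, 0 < C & forall n (a : 'I_n.+1), (3 * a < 2 * n + 1)%N ->
  #|min_family a|%:R <= C * target R a.
Proof.
have [k1 [C1 C10 H1]] := rich_large_count R.
have [k2 [C2 C20 H2]] := rich_small_count R.
have [k3 [C3 C30 H3]] := rich_mid_count R k2.
have [C4 C40 H4] := poor_count R (k1 + k2 + k3).
exists (C1 + C2 + C3 + C4); first by rewrite !addr_gt0.
move=> n a a3; have T0 : 0 <= target R a := powR_ge0 _ _.
have {}H4 := H4 n a a3; rewrite !mulrDl.
have [C1T C2T C3T] : [/\ 0 <= C1 * target R a, 0 <= C2 * target R a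
    & 0 <= C3 * target R a] by rewrite !mulr_ge0 ?(ltW C10) ?(ltW C20) ?(ltW C30).
have [na|an] := ltnP n (2 * a).
  have {}H1 := H1 n a a3 na.
  set F1 := [set A in _ | _] in H1; set F4 := [set A in _ | _] in H4.
  have : (#|min_family a| <= #|F1| + #|F4|)%N.
    apply: leq_trans (leq_card_setU _ _); apply/subset_leq_card/fintype.subsetP => A mA.
    rewrite in_setU [A \in F1]inE [A \in F4]inE mA /=; case: leqP => //= lt.
    by apply: leq_trans (ltnW lt) _; rewrite -addnA leq_addr.
  by rewrite -(ler_nat R) natrD; lra.
have {}H2 := H2 n a an; have {}H3 := H3 n a an.
set F2 := [set A in _ | _] in H2; set F3 := [set A in _ | _] in H3.
set F4 := [set A in _ | _] in H4.
have : (#|min_family a| <= #|F2| + #|F3| + #|F4|)%N.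
  apply: (@leq_trans #|F2 :|: F3 :|: F4|); last first.
    apply: leq_trans (leq_card_setU _ _) _; rewrite leq_add2r.
    exact: leq_card_setU.
  apply/subset_leq_card/fintype.subsetP => A mA.
  rewrite 2!in_setU [A \in F2]inE [A \in F3]inE [A \in F4]inE mA /=.
  case: leqP => //= /ltnW lt2; rewrite lt2 /=; case: leqP => //= /ltnW lt3.
  have [vA _ _] := min_familyP mA.
  apply: (@leq_trans (#|A :&: small n| + #|A :&: mid a|)%N).
    apply: leq_trans (leq_card_setU _ _); apply/subset_leq_card/fintype.subsetP => x.
    rewrite !inE => /andP[xA ->]; rewrite xA (valid_gt0 vA xA) /=.
    by case: leqP.
  by apply: leq_trans (leq_add lt2 lt3) _; rewrite -addnA leq_addl.
by rewrite -(ler_nat R) !natrD; lra.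
Qed.

Lemma geometric_le (R : realType) (r : R) (m : nat) : 0 < r < 1 ->
  \sum_(i < m) r ^+ (m - i) <= (1 - r)^-1.
Proof.
case/andP => r0 r1; have r1' : 0 < 1 - r by rewrite subr_gt0.
elim: m => [|m IH]; first by rewrite big_ord0 invr_ge0 ltW.
rewrite big_ord_recr /= subSnn expr1.
under eq_bigr => i _ do rewrite subSn ?(ltnW (ltn_ord i)) // exprS.
rewrite -mulr_sumr; apply: (@le_trans _ _ (r * (1 - r)^-1 + r)).
  by rewrite lerD2r ler_wpM2l // ltW.
rewrite -(ler_pM2r r1') mulrDl -mulrA mulVf ?gt_eqF // mulr1.
by have : 0 <= (1 - r) ^+ 2 := sqr_ge0 _; rewrite expr2; lra.
Qed.

Lemma valid_count (R : realType) :
  exists2 C : R, 0 < C & forall n : nat,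
  #|[set A : {set 'I_n.+1} | `[< valid A >] ]|%:R <= C * 2 `^ (n%:R / 3).
Proof.
have [C0 C00 H] := min_family_count R.
have [r r01 rE] : exists2 r : R, 0 < r < 1 & r = 2 `^ (- (1 / 1000)).
  exists (2 `^ (- (1 / 1000))) => //; apply/andP; split; first exact: pow2_gt0.
  rewrite powRN invf_lt1 ?pow2_gt0 //; apply: pow2_gt1.
  by lra.
have r1' : 0 < 1 - r by rewrite subr_gt0; case/andP: r01.
(* [f/6 = n/3 + 1/6] explains the last factor; the 2 pays for the sets without elements below [f/3],
   the quotient for the geometric series. *)
exists ((C0 / (1 - r) + 2) * 2 `^ (1 / 6)).
  by rewrite mulr_gt0 ?pow2_gt0 // addr_gt0 // divr_gt0.
move=> n; set F := [set A | _].
pose L := [set x : 'I_n.+1 | (2 * n + 1 <= 3 * x)%N].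
have cF : (#|F| <= \sum_(a < n.+1 | 3 * a < 2 * n + 1) #|min_family a| + 2 ^ #|L|)%N.
  pose E := \bigcup_(a < n.+1 | (3 * a < 2 * n + 1)%N) min_family a.
  apply: (@leq_trans (#|E| + #|powerset L|)%N).
    apply: leq_trans (leq_card_setU _ _); apply/subset_leq_card/fintype.subsetP => A.
    rewrite inE => vA; rewrite in_setU powersetE.
    have [AL|] := boolP (A \subset L); first by rewrite orbT.
    move=> /subsetPn[x0 x0A]; rewrite inE -ltnNge => x0lt.
    rewrite orbF; pose x := [arg min_(i < x0 in A) (i : nat)].
    have [xA xmin] : x \in A /\ forall y, y \in A -> (x <= y)%N.
      by rewrite /x; case: arg_minnP.
    apply/bigcupP; exists x.
      by have := xmin _ x0A; lia.
    by rewrite inE vA xA; apply/forall_inP.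
  rewrite card_powerset leq_add2r /E.
  elim/big_rec2: _ => [|a s S _ IH]; first by rewrite cards0.
  by apply: leq_trans (leq_card_setU _ _) _; rewrite leq_add2l.
have cL : #|L|%:R <= (2 * n + 1)%:R / 6 + 1 / 2 :> R.
  have : (6 * #|L| <= 2 * n + 4)%N.
    have : (#|L| <= n.+1 - (2 * n + 1 + 2) %/ 3)%N.
      apply: (@card_le_range _ _ ((2 * n + 1 + 2) %/ 3)) => x; rewrite inE.
      by have := ltn_ord x; lia.
    by lia.
  rewrite -(ler_nat R) natrM natrD natrM => HL.
  by rewrite natrD natrM; lra.
have sE (a : 'I_n.+1) : target R a = 2 `^ ((2 * n + 1)%:R / 6) * r ^+ excess a.
  rewrite /target pow2D rE -[_ ^+ excess a]powR_mulrn ?powR_ge0 // -powRrM.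
  by congr (_ * (_ `^ _)); lra.
have nE : 2 `^ ((2 * n + 1)%:R / 6) = 2 `^ (1 / 6) * 2 `^ (n%:R / 3) :> R.
  by rewrite -pow2D natrD natrM; congr (_ `^ _); lra.
move: cF; rewrite -(ler_nat R) natrD => cF; apply: (le_trans cF).
rewrite -mulrA -nE mulrDl; apply: lerD; last first.
  rewrite pow2_nat; apply: le_trans (pow2_le cL) _.
  rewrite pow2D mulrC ler_wpM2r ?powR_ge0 //.
  by rewrite -[leRHS](@powRr1 R 2) // pow2_le; lra.
rewrite natr_sum.
apply: (@le_trans _ _ (\sum_(a < n.+1 | (3 * a < 2 * n + 1)%N)
    C0 * (2 `^ ((2 * n + 1)%:R / 6) * r ^+ excess a))).
  by apply: ler_sum => a a3; rewrite -sE; exact: H.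
rewrite -!mulr_sumr -mulrA ler_wpM2l ?(ltW C00) // mulrC ler_wpM2r ?powR_ge0 //.
(* [a < m] is equivalent to [3a < f], and then [m - a <= excess a]. *)
set m := ((2 * n) %/ 3).+1.
apply: le_trans (geometric_le m r01).
have mn : (m <= n.+1)%N by rewrite /m ltnS; lia.
rewrite (big_ord_widen _ (fun i => r ^+ (m - i)) mn).
rewrite [leRHS](eq_bigl (fun a : 'I_n.+1 => 3 * a < 2 * n + 1)%N); last first.
  by move=> a; rewrite /m; lia.
apply: ler_sum => a a3; case/andP: r01 => r0 r1.
by rewrite ler_wiXn2l ?(ltW r0) ?(ltW r1) // /m /excess; lia.
Qed.

Local Close Scope ring_scope.

(** * The theorem *)

Lemma all_sums0 (A : set nat) : all_sums A 0.
Proof. by exists 0 => //; exists (fun=> 0); split; [case|rewrite big_ord0]. Qed.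

Lemma all_sums1 (A : set nat) x : A x -> all_sums A x.
Proof. by move=> Ax; exists 1 => //; exists (fun=> x); rewrite big_ord1. Qed.

Lemma all_sumsD (A : set nat) x y : all_sums A x -> all_sums A y -> all_sums A (x + y).
Proof.
move=> [k _ [u [uA ->]]] [l _ [v [vA ->]]]; exists (k + l) => //.
pose w (i : 'I_(k + l)) := match fintype.split i with inl j => u j | inr j => v j end.
exists w; split; first by rewrite /w => i; case: fintype.split.
rewrite big_split_ord /=; congr (_ + _); apply: eq_bigr => i _; rewrite /w.
  by rewrite (unsplitK (inl i)).
by rewrite (unsplitK (inr i)).
Qed.

Definition ord_set n (A : {fset nat}) : {set 'I_n.+1} :=
  [set i : 'I_n.+1 | nat_of_ord i \in A].

Lemma sum_free_avoidingP n m (A : {fset nat}) :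
  A \in sum_free_avoiding n m <->
  [/\ forall x, x \in A -> 0 < x <= n, sum_free [set` A]%classic &
      ~ all_sums [set` A]%classic m].
Proof.
have memE x : (x \in interval1 n) = (0 < x <= n).
  by rewrite /interval1 in_fset /= mem_iota add1n ltnS.
rewrite /sum_free_avoiding in_fset /= unfold_in /= fpowersetE; split.
  by move=> /andP[/fsubsetP An /asboolP[sf ns]]; split => // x /An; rewrite memE.
move=> [An sf ns]; apply/andP; split; last exact/asboolP.
by apply/fsubsetP => x /An; rewrite memE.
Qed.

Lemma valid_ord_set n (A : {fset nat}) :
  A \in sum_free_avoiding n (2 * n + 1) -> valid (ord_set n A).
Proof.
move=> /sum_free_avoidingP[An sf ns]; split.
  move=> x y z; rewrite !inE => xA yA zA xyz; apply: sf.
  by exists x, y, z.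
exists (all_sums [set` A]%classic); split => //.
- exact: all_sums0.
- by move=> x y; exact: all_sumsD.
- by move=> x; rewrite inE => xA; exact: all_sums1.
Qed.

Lemma card_sum_free_avoiding_le n :
  #|` sum_free_avoiding n (2 * n + 1)| <= #|[set A : {set 'I_n.+1} | `[< valid A >] ]|.
Proof.
rewrite cardE -(size_map (ord_set n)); apply: uniq_leq_size.
  rewrite map_inj_in_uniq ?fset_uniq // => A B.
  move=> /sum_free_avoidingP[An _ _] /sum_free_avoidingP[Bn _ _] E.
  apply/fsetP => x; have EE (i : 'I_n.+1) : (nat_of_ord i \in A) = (nat_of_ord i \in B).
    by have := congr1 (fun S : {set 'I_n.+1} => i \in S) E; rewrite !inE.
  case: (leqP x n) => xn; first by have := EE (inord x); rewrite inordK.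
  have nA : x \notin A by apply/negP => /An/andP[_]; rewrite leqNgt xn.
  have nB : x \notin B by apply/negP => /Bn/andP[_]; rewrite leqNgt xn.
  by rewrite (negbTE nA) (negbTE nB).
move=> _ /mapP[A AS ->]; rewrite mem_enum inE; apply/asboolP.
exact: valid_ord_set.
Qed.

(** Two such elements add up to more than [n], which gives sum-freeness. At most two terms sum to at
    most [2n], and three or more to more than [f]. *)
Lemma sum_free_avoiding_large n (A : {fset nat}) :
  (forall x, x \in A -> x <= n /\ 2 * n + 1 < 3 * x) ->
  A \in sum_free_avoiding n (2 * n + 1).
Proof.
move=> An; apply/sum_free_avoidingP; split.
- by move=> x /An[]; lia.
- by move=> [x [y [z [/= /An + /An + /An + +]]]]; lia.
- move=> [k _ [u [uA sE]]].
  have up : \sum_(i < k) u i <= k * n.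
    have -> : k * n = \sum_(i < k) n by rewrite sum_nat_const card_ord.
    apply: leq_sum => i _.
    by have [] := An _ (uA i).
  have lo : k * (2 * n + 2) <= 3 * \sum_(i < k) u i.
    have -> : k * (2 * n + 2) = \sum_(i < k) (2 * n + 2).
      by rewrite sum_nat_const card_ord.
    rewrite big_distrr /=; apply: leq_sum => i _.
    by have [] := An _ (uA i); lia.
  move: up lo; rewrite -sE; case: k {u uA sE} => [|[|[|k]]]; nia.
Qed.

Lemma card_sum_free_avoiding_ge n :
  2 ^ (n - (2 * n + 1) %/ 3) <= #|` sum_free_avoiding n (2 * n + 1)|.
Proof.
set l := (2 * n + 1) %/ 3.
have ln : l <= n by rewrite /l; lia.
pose g (S : {set 'I_(n - l)}) : {fset nat} := [fset (l.+1 + val i)%N | i in S]%fset.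
have gE (S : {set 'I_(n - l)}) x :
    reflect (exists2 i : 'I_(n - l), i \in S & x = l.+1 + i) (x \in g S).
  exact: (iffP (imfsetP _ _ _ _)).
rewrite -[X in 2 ^ X](card_ord (n - l)) -cardsT -card_powerset cardE -(size_map g).
apply: uniq_leq_size.
  rewrite map_inj_uniq ?enum_uniq // => S S' E; apply/setP => i.
  have mem T : (l.+1 + i \in g T) = (i \in T).
    apply/gE/idP => [[j jT /eqP]|iT]; last by exists i.
    by rewrite eqn_add2l => /eqP/val_inj ->.
  by rewrite -mem E mem.
move=> _ /mapP[S _ ->]; apply: sum_free_avoiding_large => x /gE[i _ ->].
by have := ltn_ord i; rewrite /l; lia.
Qed.

Local Open Scope classical_set_scope.
Local Open Scope ring_scope.

Theorem theorem1p3 (R : realType) :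
  (fun n : nat => (#|` sum_free_avoiding n (2 * n + 1)|)%:R : R^o)
    \is 'Theta_\oo (fun n : nat => 2 `^ (n%:R / 3) : R^o).
Proof.
have [C C0 HC] := valid_count R.
(* The lower constant [1/2] is ample: rounding costs at most [1/3] in the exponent. *)
rewrite qualifE; apply/asboolP; exists (1 / 2, C) => /=.
  by rewrite C0 andbT divr_gt0.
apply: nearW => n; rewrite !ger0_norm ?powR_ge0 //; split; last first.
  by apply: le_trans (HC n); rewrite ler_nat card_sum_free_avoiding_le.
apply: (@le_trans _ _ ((2 ^ (n - (2 * n + 1) %/ 3))%:R)); last first.
  by rewrite ler_nat card_sum_free_avoiding_ge.
rewrite pow2_nat div1r -[2^-1]/((2 : R)^-1) -{1}(@powRr1 R 2) // -powRN -pow2D.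
apply: pow2_le.
have H : (n <= 3 * (n - (2 * n + 1) %/ 3) + 1)%N by lia.
by move: H; rewrite -(ler_nat R) natrD natrM; lra.
Qed.
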